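(* Let $n \ge 3$ and $g \in \mathrm{SL}(n,\mathbb{Z})$. Let $f_1,\ldots,f_r \in \mathbb{Q}[x]$ be the characteristic polynomials of the blocks of the rational canonical form of $g$ (over $\mathbb{Q}$). If the $f_i$'s are pairwise coprime, then there exists a unipotent element $u \in \mathrm{SL}(n,\mathbb{Z})$ such that for every integer $m \ge 1$ the subgroup $\langle g, u^m\rangle$ generated by $g$ and $u^m$ has finite index in $\mathrm{SL}(n,\mathbb{Z})$, i.e. $[\mathrm{SL}(n,\mathbb{Z}):\langle g,u^m\rangle]<\infty$.
   Context: The rational canonical form of $g$ is a block diagonal matrix over $\mathbb{Q}$, conjugate to $g$ in $\mathrm{GL}(n,\mathbb{Q})$. Its blocks are the companion matrices of the elementary divisors of $g$ (listed with multiplicity), which are powers of monic irreducible polynomials in $\mathbb{Q}[x]$; the characteristic polynomial of each block is the corresponding elementary divisor. (If one instead uses the version whose blocks are the companion matrices of the invariant factors, the condition that the polynomials $f_1,\ldots,f_r$ are pairwise coprime is equivalent.) A matrix $u$ is unipotent if $u-\mathrm{Id}$ is nilpotent. *)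

(* Defs.v *)
From HB Require Import structures.
From mathcomp Require Import all_boot all_order all_algebra.
From mathcomp Require Import boolp classical_sets cardinality.

Set Implicit Arguments.
Unset Strict Implicit.
Unset Printing Implicit Defensive.

Import GRing.Theory.
Local Open Scope ring_scope.
Local Open Scope classical_set_scope.

Definition SL (R : comUnitRingType) (n : nat) : Type :=
  {A : 'M[R]_n | \det A == 1}.

Section SLGroup.
Variables (R : comUnitRingType) (n : nat).
Implicit Types A B : SL R n.

HB.instance Definition _ := SubChoice.on (SL R n).

Fact SL_mul_subproof A B : \det (val A *m val B) == 1.
Proof. by rewrite det_mulmx (eqP (valP A)) (eqP (valP B)) mulr1. Qed.

Fact SL_one_subproof : \det (1%:M : 'M[R]_n) == 1.
Proof. by rewrite det1. Qed.

Fact SL_inv_subproof A : \det (invmx (val A)) == 1.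
Proof. by rewrite det_inv (eqP (valP A)) invr1. Qed.

Definition SL_mul A B : SL R n := Sub (val A *m val B) (SL_mul_subproof A B).
Definition SL_one : SL R n := Sub 1%:M SL_one_subproof.
Definition SL_inv A : SL R n := Sub (invmx (val A)) (SL_inv_subproof A).

Lemma SL_unitmx A : val A \in unitmx.
Proof. by rewrite unitmxE (eqP (valP A)) unitr1. Qed.

Fact SL_mulA : associative SL_mul.
Proof. by move=> A B C; apply: val_inj; rewrite /= mulmxA. Qed.

Fact SL_mul1 : left_id SL_one SL_mul.
Proof. by move=> A; apply: val_inj; rewrite /= mul1mx. Qed.

Fact SL_mulr1 : right_id SL_one SL_mul.
Proof. by move=> A; apply: val_inj; rewrite /= mulmx1. Qed.

Fact SL_mulV : left_inverse SL_one SL_inv SL_mul.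
Proof. by move=> A; apply: val_inj; rewrite /= mulVmx ?SL_unitmx. Qed.

Fact SL_mulVr : right_inverse SL_one SL_inv SL_mul.
Proof. by move=> A; apply: val_inj; rewrite /= mulmxV ?SL_unitmx. Qed.

HB.instance Definition _ :=
  isGroup.Build (SL R n) SL_mulA SL_mul1 SL_mulr1 SL_mulV SL_mulVr.

End SLGroup.

Definition unipotent (R : comUnitRingType) (n : nat) (u : SL R n) : Prop :=
  exists k : nat, (val u - 1%:M) ^+ k = 0.

Section Subgroups.
Variable G : groupType.

Definition subgroup (H : set G) : Prop :=
  [/\ H 1%g,
      (forall x y, H x -> H y -> H (x * y)%g)
    & (forall x, H x -> H x^-1%g)].

Definition generated (S : set G) : set G := smallest subgroup S.

Definition left_coset (H : set G) (x : G) : set G := [set (x * h)%g | h in H].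

Definition finite_index (H : set G) : Prop := finite_set (range (left_coset H)).

End Subgroups.

(* The d i are the elementary divisors of A, with multiplicity. The equality e *)
(* is needed only because mxdiag has the sum of the block sizes as dimension.  *)
Definition rational_canonical_form (F : fieldType) (n : nat) (A : 'M[F]_n)
    (r : nat) (d : 'I_r -> {poly F}) : Prop :=
  (forall i, exists q : {poly F}, exists k : nat,
     [/\ q \is monic, irreducible_poly q, (0 < k)%N & d i = q ^+ k]) /\
  exists e : (\sum_(i < r) (size (d i)).-1)%N = n,
    A ~_{in unitmx} castmx (e, e) (\mxdiag_(i < r) companionmx (d i)).

(* Main.v *)
Require Import Defs.
From HB Require Import structures.
From mathcomp Require Import all_boot all_order all_algebra.
From mathcomp Require Import boolp classical_sets cardinality.
From mathcomp Require Import generic_quotient ring zify.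
Set Implicit Arguments.
Unset Strict Implicit.
Unset Printing Implicit Defensive.
Import GRing.Theory Num.Theory.
Local Open Scope ring_scope.
Local Open Scope classical_set_scope.

(** Pairwise coprimality of the elementary divisors of g gives Q^n a cyclic row
    vector w: the rows w_j = w g^j with j < n form a basis (cyclic_row_vector).
    Take for v a column with w_j v = 0 for j < n - 1 and w_{n-1} v <> 0, scale
    both to be integral, and let u be the transvection 1 + v w.

    Conjugating u^m by g^i shows that < g, u^m > contains all 1 + m t v_i w_i,
    where v_i = g^-i v and t is an integer. The pairing w_j v_i depends on
    j - i only; it vanishes for 0 <= j - i <= n - 2, and w_i v_{i+1} <> 0. The
    commutator of two transvections 1 + x y and 1 + x' y' with y' x = 0 is
    1 + (y x') x y'; hence these commutators produce multiples of all v_i w_j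
    with 0 <= j - i <= n - 2. In the dual basis b_l of the w_j, each v_{l+1} is
    a nonzero multiple of b_l up to earlier b's and v_0 is a nonzero multiple
    of b_{n-1}, so the group contains multiples of all b_i w_j with i <> j
    (virtual_transv_dual). These are the elementary matrices of the rational
    basis w_j, up to a common multiple q.

    For n >= 3, a group that contains the elementary matrices with entries in
    q Z contains all 1 + q^2 x y with x unimodular and y x = 0
    (transv_in_of_elementary). Conjugating back by the basis w_j,
    < g, u^m > contains every 1 + K x y with x unimodular and y x = 0, for a
    single K > 1 (relative_elementary_sub). These generate a normal subgroup N
    of SL(n, Z).

    It remains to see that N has finite index. The matrices congruent to 1
    modulo K are central modulo N: each can be brought, using N and one
    conjugation, to a matrix fixing a basis column and row, which commutes
    modulo N with the elementary matrices in that column and row, and those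
    generate SL(n, Z) (central_congruent). So the centre of SL(n, Z) / N has finite
    index, and by Schur's theorem the derived subgroup of this quotient is
    finite (schur_finite); but SL(n, Z) is perfect (SL_perfect). *)

(** * Transvections and elementary matrices *)

Lemma third_index n (i j : 'I_n) : (3 <= n)%N -> i != j ->
  exists k, (k != i) && (k != j).
Proof.
move=> n3 ij; have : (0 < #|~: [set i; j]|)%N.
  by rewrite cardsCs finset.setCK cards2 card_ord ij subn_gt0.
by case/card_gt0P => k; rewrite !inE negb_or; exists k.
Qed.

Section Transvections.
Variables (R : comNzRingType) (n : nat).
Implicit Types (x z : 'cV[R]_n) (y : 'rV[R]_n) (c t q : R) (P : 'M[R]_n -> Prop).

(** A submonoid of matrices; the inverse of a transvection 1 + X enters arguments as
    the transvection 1 - X. *)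
Definition mul_closed P := P 1%:M /\ forall A B, P A -> P B -> P (A *m B).

Definition transv_in P x y := y *m x = 0 /\ P (1%:M + x *m y).

Definition ecol (i : 'I_n) : 'cV[R]_n := delta_mx i 0.
Definition erow (i : 'I_n) : 'rV[R]_n := delta_mx 0 i.

Lemma transv_mul x y x' y' : y *m x' = 0 ->
  (1%:M + x *m y) *m (1%:M + x' *m y') = 1%:M + (x *m y + x' *m y').
Proof.
move=> yx; rewrite mulmxDl !mulmxDr !mulmx1 !mul1mx.
by rewrite [x *m y *m _]mulmxA -(mulmxA x) yx mulmx0 mul0mx addr0 -addrA (addrC (x' *m y')).
Qed.

Lemma transv_in0l P y : mul_closed P -> transv_in P 0 y.
Proof. by case=> P1 _; split; rewrite ?mulmx0 // mul0mx addr0. Qed.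

Lemma transv_in0r P x : mul_closed P -> transv_in P x 0.
Proof. by case=> P1 _; split; rewrite ?mul0mx // mulmx0 addr0. Qed.

Lemma transv_inDl P x x' y : mul_closed P ->
  transv_in P x y -> transv_in P x' y -> transv_in P (x + x') y.
Proof.
move=> [_ PM] [yx Px] [yx' Px']; split; first by rewrite mulmxDr yx yx' addr0.
by rewrite mulmxDl -transv_mul //; apply: PM.
Qed.

Lemma transv_inDr P x y y' : mul_closed P ->
  transv_in P x y -> transv_in P x y' -> transv_in P x (y + y').
Proof.
move=> [_ PM] [yx Px] [yx' Px']; split; first by rewrite mulmxDl yx yx' addr0.
by rewrite mulmxDr -transv_mul //; apply: PM.
Qed.

Lemma transv_in_suml P I (r : seq I) (Q : pred I) (F : I -> 'cV[R]_n) y : mul_closed P ->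
  (forall i, Q i -> transv_in P (F i) y) -> transv_in P (\sum_(i <- r | Q i) F i) y.
Proof.
move=> cP; apply: (big_ind (fun x => transv_in P x y)) => [|x x'].
  exact: transv_in0l.
exact: transv_inDl.
Qed.

Lemma transv_in_sumr P I (r : seq I) (Q : pred I) x (F : I -> 'rV[R]_n) : mul_closed P ->
  (forall i, Q i -> transv_in P x (F i)) -> transv_in P x (\sum_(i <- r | Q i) F i).
Proof.
move=> cP; apply: (big_ind (fun y => transv_in P x y)) => [|y y'].
  exact: transv_in0r.
exact: transv_inDr.
Qed.

Lemma transv_inC P c x y : transv_in P (c *: x) y <-> transv_in P x (c *: y).
Proof. by rewrite /transv_in -scalemxAl -!scalemxAr -scalemxAl. Qed.

(** Here (1 + X) (1 + Y) = (1 + X Y) (1 + Y) (1 + X), while 1 - X and 1 - Y are the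
    inverses of 1 + X and 1 + Y. *)
Lemma commutator_square_zero (A : pzRingType) (X Y : A) :
  X * X = 0 -> Y * Y = 0 -> Y * X = 0 ->
  (1 + X) * (1 + Y) * (1 - X) * (1 - Y) = 1 + X * Y.
Proof.
move=> XX YY YX.
have -> : (1 + X) * (1 + Y) = (1 + X * Y) * (1 + Y) * (1 + X).
  rewrite !(mulrDl, mulrDr, mul1r, mulr1) -!mulrA YX mulr0 YY mulr0 mulr0 !addr0.
  by rewrite mulr0 add0r addr0 -!addrA (addrC (X * Y)).
have sqr (Z : A) : Z * Z = 0 -> (1 + Z) * (1 - Z) = 1.
  by move=> ZZ; rewrite mulrBr mulr1 mulrDl mul1r ZZ addr0 addrK.
by rewrite -!mulrA (mulrA (1 + X) (1 - X)) sqr // mul1r sqr // mulr1.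
Qed.

Lemma transv_commutator x y x' y' : y *m x = 0 -> y' *m x' = 0 -> y' *m x = 0 ->
  (1%:M + x *m y) *m (1%:M + x' *m y') *m (1%:M + - x *m y) *m (1%:M + - x' *m y') =
  1%:M + ((y *m x') 0 0 *: x) *m y'.
Proof.
move=> yx yx' yx0.
have E (a a' : 'cV[R]_n) (b b' : 'rV[R]_n) :
    (a *m b) *m (a' *m b') = (b *m a') 0 0 *: (a *m b').
  by rewrite mulmxA -(mulmxA a) {1}[b *m a']mx11_scalar mul_mx_scalar scalemxAl.
rewrite !mulNmx; have := @commutator_square_zero 'M[R]_n (x *m y) (x' *m y').
rewrite -!mulmxE !E yx yx' yx0 mxE !scale0r => -> //.
by rewrite scalemxAl.
Qed.

Lemma transv_in_comm P x y x' y' : mul_closed P ->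
  transv_in P x y -> transv_in P (- x) y -> transv_in P x' y' -> transv_in P (- x') y' ->
  y' *m x = 0 ->
  transv_in P ((y *m x') 0 0 *: x) y'.
Proof.
move=> [_ PM] [yx P1] [_ P2] [yx' P3] [_ P4] yx0; split.
  by rewrite -scalemxAr yx0 scaler0.
rewrite -transv_commutator //; exact: PM _ _ (PM _ _ (PM _ _ P1 P3) P2) P4.
Qed.

Lemma erow_ecol i j : erow i *m ecol j = (i == j)%:R%:M.
Proof.
rewrite /erow /ecol mul_delta_mx_cond; apply/matrixP => a b.
by rewrite !ord1 !mxE eqxx mulr1n; case: (i == j); rewrite ?mulr1n ?mulr0n !mxE.
Qed.

Lemma row_mul_ecol y j : y *m ecol j = (y 0 j)%:M.
Proof. by rewrite -colE; apply/matrixP=> a b; rewrite !ord1 !mxE eqxx mulr1n. Qed.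

Lemma erow_mul_col x i : erow i *m x = (x i 0)%:M.
Proof. by rewrite -rowE; apply/matrixP=> a b; rewrite !ord1 !mxE eqxx mulr1n. Qed.

Lemma cV_sum_ecol x : x = \sum_i x i 0 *: ecol i.
Proof.
by rewrite [LHS]matrix_sum_delta; apply: eq_bigr => i _; rewrite big_ord1.
Qed.

Lemma rV_sum_erow y : y = \sum_i y 0 i *: erow i.
Proof. by rewrite [LHS]matrix_sum_delta big_ord1. Qed.

(** Suslin's argument. The row (z x) y is the sum over i, j of the rows
    z_i y_j (x_i e_j - x_j e_i), because y x = 0 cancels the second terms; each
    of these rows kills x, so the corresponding transvections multiply to the one of
    x and (z x) y. Such a row w vanishes off i and j. The part of x off i and j gives
    a product of elementary matrices, and the part p supported on i and j gives
    the commutator of 1 + q p e_k and 1 + q e_k w for a third index k: this is where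
    n >= 3 and the square of q come from. The factor z x replaces unimodularity of
    x, so that x may also be a vector expressed in another basis. *)
Lemma transv_in_of_elementary P q x y z : (3 <= n)%N -> mul_closed P ->
  (forall i j t, i != j -> transv_in P (ecol i) (q * t *: erow j)) ->
  y *m x = 0 -> transv_in P x (q ^+ 2 * (z^T *m x) 0 0 *: y).
Proof.
move=> n3 cP Pij yx.
have Pcol k (p : 'cV[R]_n) : p k 0 = 0 -> transv_in P p (q *: erow k).
  move=> pk; rewrite (cV_sum_ecol p) (bigD1 k) //= pk scale0r add0r.
  apply: transv_in_suml => // i ik; apply/transv_inC; rewrite scalerA mulrC; exact: Pij.
have Prow k (w : 'rV[R]_n) : w 0 k = 0 -> transv_in P (ecol k) (q *: w).
  move=> wk; rewrite (rV_sum_erow w) (bigD1 k) //= wk scale0r add0r scaler_sumr.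
  by apply: transv_in_sumr => // i ik; rewrite scalerA; apply: Pij; rewrite eq_sym.
have Pp k (p : 'cV[R]_n) (w : 'rV[R]_n) : 
    p k 0 = 0 -> w 0 k = 0 -> w *m p = 0 -> transv_in P p (q ^+ 2 *: w).
  move=> pk wk wp.
  have := @transv_in_comm P p (q *: erow k) (ecol k) (q *: w) cP.
  have -> : (q *: erow k *m ecol k) 0 0 = q.
    by rewrite -scalemxAl erow_ecol eqxx !mxE mulr1n mulr1.
  move=> /(_ (Pcol _ _ pk) _ (Prow _ _ wk)) H; rewrite expr2 -scalerA; apply/transv_inC; apply: H.
  - by apply: Pcol; rewrite mxE pk oppr0.
  - rewrite -scaleN1r; apply/transv_inC; rewrite scalerA mulN1r -mulrN1 -scalerA.
    by apply: Prow; rewrite mxE wk mulr0.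
  by rewrite -scalemxAl wp scaler0.
have Pij2 i j c : i != j -> transv_in P x (q ^+ 2 * c *: (x i 0 *: erow j - x j 0 *: erow i)).
  move=> ij; set v := _ - _.
  have vk k : k != i -> k != j -> v 0 k = 0.
    by move=> /negPf ki /negPf kj; rewrite !mxE !eqxx ki kj !mulr0 subr0.
  rewrite {1}(cV_sum_ecol x) (bigD1 i) //= (bigD1 j) 1?eq_sym //= addrA.
  apply: transv_inDl => //; last first.
    apply: transv_in_suml => // k /andP[ki kj]; apply/transv_inC.
    rewrite scalerA expr2 -!mulrA mulrCA -scalerA; apply: Prow.
    by rewrite mxE vk ?mulr0.
  have [k /andP[ki kj]] := third_index n3 ij.
  rewrite -scalerA; apply: (Pp k).
  - by rewrite !mxE (negPf ki) (negPf kj) !mulr0 addr0.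
  - by rewrite mxE vk ?mulr0.
  rewrite -scalemxAl mulmxDr -!scalemxAr !row_mul_ecol !mxE !eqxx (negPf ij).
  rewrite eq_sym (negPf ij) !mulr0 !mulr1 subr0 sub0r raddfN /= scalerN.
  by rewrite !scale_scalar_mx mulrC addNr scaler0.
rewrite -scalerA; have -> : (z^T *m x) 0 0 *: y =
    \sum_i \sum_j (z i 0 * y 0 j) *: (x i 0 *: erow j - x j 0 *: erow i).
  have zx : (z^T *m x) 0 0 = \sum_i z i 0 * x i 0.
    by rewrite mxE; apply: eq_bigr => i _; rewrite mxE.
  have {}yx : \sum_j y 0 j * x j 0 = 0.
    by have := congr1 (fun A : 'M_1 => A 0 0) yx; rewrite !mxE.
  rewrite zx scaler_suml; apply: eq_bigr => i _.
  rewrite (eq_bigr (fun j => (z i 0 * x i 0) *: (y 0 j *: erow j)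
     - (y 0 j * x j 0) *: (z i 0 *: erow i))); last first.
    by move=> j _; rewrite scalerBr !scalerA; congr (_ *: _ - _ *: _); ring.
  by rewrite sumrB -scaler_sumr -rV_sum_erow -scaler_suml yx scale0r subr0.
rewrite scaler_sumr; apply: transv_in_sumr => // i _.
rewrite scaler_sumr; apply: transv_in_sumr => // j _; rewrite scalerA.
by case: (eqVneq i j) => [->|]; [rewrite subrr scaler0; exact: transv_in0r | exact: Pij2].
Qed.
End Transvections.

(** * Groups with a centre of finite index *)

Section Schur.
Local Open Scope group_scope.
Variables (G : groupType) (F : finType) (f : G -> F).
Hypothesis f_center : forall x y z, f x = f y -> commute (x^-1 * y) z.

Definition fiber_rep (a : F) : G :=
  if pselect (exists x, f x = a) is left e then projT1 (cid e) else 1.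

Definition comm_of (p : F * F) : G := [~ fiber_rep p.1, fiber_rep p.2].

Lemma fiber_repK x : f (fiber_rep (f x)) = f x.
Proof. by rewrite /fiber_rep; case: pselect => [e|[]]; [case: cid | exists x]. Qed.

(** Central factors drop out of a commutator, so there are only finitely many
    commutators. *)
Lemma commg_fiber x y : [~ x, y] = comm_of (f x, f y).
Proof.
rewrite /comm_of /=; set x' := fiber_rep (f x); set y' := fiber_rep (f y).
pose a := x'^-1 * x; pose b := y'^-1 * y.
have aC z : commute a z by apply: f_center; rewrite fiber_repK.
have bC z : commute b z by apply: f_center; rewrite fiber_repK.
have -> : x = a * x' by rewrite aC /a mulVKg.
have -> : y = y' * b by rewrite /b mulVKg.
have fixC (u z : G) : (forall v, commute u v) -> z ^ u = z.
  by move=> uC; rewrite conjgE -(uC z) mulKg.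
have fixa u : a ^ u = a by rewrite conjgE aC mulKg.
by rewrite !commgEl conjMg invgM fixa conjgM (fixC b) // -mulgA mulKg.
Qed.

Lemma conjg_comm_of p z : exists p', comm_of p ^ z = comm_of p'.
Proof. by eexists; rewrite conjRg commg_fiber. Qed.

(** A conjugate of a commutator is a commutator, so all occurrences of one
    commutator can be moved to the front without lengthening the product. *)
Lemma comm_prod_pull p (s : seq (F * F)) : exists2 s' : seq (F * F),
  size s = (count_mem p s + size s')%N &
  \prod_(q <- s) comm_of q = comm_of p ^+ count_mem p s * \prod_(q <- s') comm_of q.
Proof.
elim: s => [|d s [s' es ep]]; first by exists [::]; rewrite ?big_nil ?mulg1.
rewrite big_cons ep /= es; have [->|ndp] := eqVneq d p.
  by exists s'; rewrite ?add1n // expgS mulgA.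
have [d' ed] := conjg_comm_of d (comm_of p ^+ count_mem p s).
exists (d' :: s'); first by rewrite /= addnS.
by rewrite add0n mulgA (conjgC (comm_of d)) ed big_cons !mulgA.
Qed.

(** Two of the first #|F| + 1 powers share a fibre. *)
Lemma comm_of_power p : exists2 e, (0 < e <= #|F|)%N & forall z, commute (comm_of p ^+ e) z.
Proof.
set c := comm_of p.
have /injectivePn[i [j ij]] : ~~ injectiveb (fun i : 'I_#|F|.+1 => f (c ^+ i)).
  apply/negP => /injectiveP/leq_card; by rewrite card_ord ltnn.
wlog lij : i j ij / (i < j)%N => [H|] eij.
  by case: (ltngtP i j) ij => [lij|lij|/ord_inj ->]; rewrite ?eqxx // => ij;
    [apply: (H i j) | apply: (H j i) => //; rewrite eq_sym].
exists (j - i)%N; first by have := ltn_ord j; lia.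
move=> z; rewrite expgnFr 1?ltnW //.
have -> : c ^+ j / c ^+ i = (c ^+ i)^-1 * c ^+ j.
  exact/commuteV/commuteX2/commute_refl.
exact: f_center.
Qed.

(** With c = [~ x, y] and c ^+ e central, moving c ^+ e next to y inside one factor c
    gives c ^+ e.+1 = [~ x, y * y] * (c ^+ e.-1) ^ y, where the conjugate of c is
    [~ x ^ y, y]: one commutator has been saved. *)
Lemma comm_power_shorten p e : (0 < e)%N -> (forall z, commute (comm_of p ^+ e) z) ->
  exists2 s : seq (F * F), size s = e & comm_of p ^+ e.+1 = \prod_(q <- s) comm_of q.
Proof.
case: e => // e _; rewrite -[comm_of p]/[~ fiber_rep p.1, fiber_rep p.2].
move: (fiber_rep p.1) (fiber_rep p.2) => x y cC.
exists ((f x, f (y * y)) :: nseq e (f (x ^ y), f y)); first by rewrite /= size_nseq.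
rewrite big_cons -commg_fiber.
have -> : \prod_(q <- nseq e (f (x ^ y), f y)) comm_of q = ([~ x, y] ^+ e) ^ y.
  elim: e {cC} => [|e IH]; first by rewrite big_nil conj1g.
  by rewrite big_cons IH -commg_fiber expgS conjMg conjRg (conjgE y y) mulKg.
have -> : [~ x, y] ^+ e.+2 = x^-1 * (y^-1 * x) * ([~ x, y] ^+ e.+1 * y).
  by rewrite cC expgS {1}commgEl conjgE !mulgA.
rewrite expgS !commgEl !conjgE invgM -!mulgA.
by rewrite !mulVKg.
Qed.

Lemma pigeonhole_count (T : finType) (s : seq T) k :
  (#|T| * k < size s)%N -> exists p, (k < count_mem p s)%N.
Proof.
apply: contraPP => /forallNP H; apply/negP; rewrite -leqNgt.
have -> : size s = (\sum_(p : T) count_mem p s)%N.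
  elim: s {H} => [|x s IH]; first by rewrite big1.
  rewrite /= big_split /= -IH (bigD1 x) //= eqxx big1 ?addn0 // => i.
  by rewrite eq_sym => /negPf ->.
rewrite -sum_nat_const; apply: leq_sum => p _; rewrite leqNgt; exact/negP.
Qed.

(** In a long product some commutator occurs often enough to be shortened. *)
Lemma comm_prod_bounded (s : seq (F * F)) : exists2 s' : seq (F * F),
  (size s' <= #|{: F * F}| * #|F|)%N & \prod_(q <- s) comm_of q = \prod_(q <- s') comm_of q.
Proof.
elim: {s}(size s) {-2}s (leqnn (size s)) => [|m IH] s sm.
  by exists s => //; apply: leq_trans sm _.
have [|big] := leqP (size s) (#|{: F * F}| * #|F|); first by exists s.
have [p kp] := pigeonhole_count big.
have [s1 e1 ->] := comm_prod_pull p s.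
have [e /andP[e0 eF] cC] := comm_of_power p.
have [s2 e2 E2] := comm_power_shorten e0 cC.
have -> : count_mem p s = (e.+1 + (count_mem p s - e.+1))%N by lia.
rewrite expgnDr E2.
have nE m' : \prod_(q <- nseq m' p) comm_of q = comm_of p ^+ m'.
  by elim: m' => [|m' IHm]; rewrite ?big_nil // big_cons IHm expgS.
have [|s' sz E'] := IH (s2 ++ nseq (count_mem p s - e.+1) p ++ s1).
  rewrite !size_cat size_nseq e2 addnA; rewrite e1 in sm; rewrite -ltnS.
  apply: leq_trans sm; rewrite ltn_add2r.
  by move: (leq_ltn_trans eF kp); move: (count_mem p s) => a ea; clear -ea; lia.
by exists s' => //; rewrite -E' !big_cat nE -mulgA.
Qed.

Hypothesis perfect : forall x, exists s : seq (G * G), x = \prod_(p <- s) [~ p.1, p.2].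

(** Schur's theorem, for a perfect group: a bounded number of factors from a
    finite set leaves finitely many elements. *)
Theorem schur_finite : finite_set [set: G].
Proof.
pose M := (#|{: F * F}| * #|F|)%N.
have : [set: G] `<=` (fun t : M.-bseq (F * F) => \prod_(p <- t) comm_of p) @` [set: _].
  move=> x _; have [s ->] := perfect x.
  have -> : \prod_(p <- s) [~ p.1, p.2] = \prod_(p <- [seq (f q.1, f q.2) | q <- s]) comm_of p.
    by rewrite big_map; apply: eq_bigr => p _; rewrite commg_fiber.
  have [s' sz ->] := comm_prod_bounded [seq (f q.1, f q.2) | q <- s].
  by exists (Bseq sz).
move=> /sub_finite_set; apply; apply: finite_image; exact: finite_finset.
Qed.
End Schur.

(** * Quotient of a group by a normal subgroup *)

Definition normal_subgroup (G : groupType) (N : set G) :=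
  subgroup N /\ forall x y, N x -> N (x ^ y)%g.

Section Quotient.
Local Open Scope group_scope.
Local Open Scope quotient_scope.
Variables (G : groupType) (N : set G) (nN : normal_subgroup N).

Let N1 : N 1. Proof. by case: nN => [[]]. Qed.
Let NM x y : N x -> N y -> N (x * y). Proof. case: nN => [[_ H _] _]; exact: H. Qed.
Let NV x : N x -> N x^-1. Proof. case: nN => [[_ _ H] _]; exact: H. Qed.
Let NJ x y : N x -> N (x ^ y). Proof. case: nN => [_ H]; exact: H. Qed.

Definition coset_rel (x y : G) := `[< N (x^-1 * y) >].

Fact coset_rel_refl : reflexive coset_rel.
Proof. by move=> x; apply/asboolP; rewrite mulVg. Qed.

Fact coset_rel_sym : symmetric coset_rel.
Proof.
have E x y : coset_rel x y -> coset_rel y x.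
  by move=> /asboolP/NV; rewrite invgM invgK => h; apply/asboolP.
by move=> x y; apply/idP/idP; exact: E.
Qed.

Fact coset_rel_trans : transitive coset_rel.
Proof.
move=> y x z /asboolP xy /asboolP yz; apply/asboolP.
by have := NM xy yz; rewrite mulgA mulgK.
Qed.

Canonical coset_equiv := EquivRel coset_rel coset_rel_refl coset_rel_sym coset_rel_trans.

Definition quot := {eq_quot coset_equiv}.
HB.instance Definition _ := Choice.on quot.
HB.instance Definition _ := EqQuotient.on quot.

Lemma quot_projE x y : (\pi_quot x = \pi_quot y) <-> N (x^-1 * y).
Proof.
by split=> [/eqP|h]; [|apply/eqP]; rewrite piE /= /coset_rel;
   [move/asboolP | apply/asboolP].
Qed.

Lemma repr_cong x : N ((repr (\pi_quot x))^-1 * x).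
Proof. by apply/quot_projE; rewrite reprK. Qed.

Definition quot_mul (a b : quot) : quot := \pi_quot (repr a * repr b).
Definition quot_inv (a : quot) : quot := \pi_quot (repr a)^-1.
Definition quot_one : quot := \pi_quot 1.

Lemma quot_mulE x y : quot_mul (\pi_quot x) (\pi_quot y) = \pi_quot (x * y).
Proof.
apply/quot_projE; set x' := repr _; set y' := repr _.
have -> : (x' * y')^-1 * (x * y) = (x'^-1 * x) ^ y' * (y'^-1 * y).
  by rewrite conjgE invgM !mulgA mulgK.
by apply: NM; [apply: NJ|]; exact: repr_cong.
Qed.

Lemma quot_invE x : quot_inv (\pi_quot x) = \pi_quot x^-1.
Proof.
apply/quot_projE; set x' := repr _; rewrite invgK.
have -> : x' * x^-1 = ((x'^-1 * x) ^ x'^-1)^-1.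
  by rewrite conjgE invgK !mulgA mulgV mul1g invgM invgK.
by apply/NV/NJ; exact: repr_cong.
Qed.

Fact quot_mulA : associative quot_mul.
Proof.
move=> a b c; elim/quotW: a => a; elim/quotW: b => b; elim/quotW: c => c.
by rewrite (quot_mulE b c) (quot_mulE a (b * c)) (quot_mulE a b) (quot_mulE (a * b) c) mulgA.
Qed.
Fact quot_mul1 : left_id quot_one quot_mul.
Proof. by elim/quotW=> a; rewrite quot_mulE mul1g. Qed.
Fact quot_mulr1 : right_id quot_one quot_mul.
Proof. by elim/quotW=> a; rewrite quot_mulE mulg1. Qed.
Fact quot_mulV : left_inverse quot_one quot_inv quot_mul.
Proof. by elim/quotW=> a; rewrite quot_invE quot_mulE mulVg. Qed.
Fact quot_mulVr : right_inverse quot_one quot_inv quot_mul.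
Proof. by elim/quotW=> a; rewrite quot_invE quot_mulE mulgV. Qed.

HB.instance Definition _ :=
  isGroup.Build quot quot_mulA quot_mul1 quot_mulr1 quot_mulV quot_mulVr.

Definition quot_proj (x : G) : quot := \pi_quot x.

Fact quot_proj_morph : {morph quot_proj : x y / x * y}.
Proof. move=> x y; exact: (esym (quot_mulE x y)). Qed.

HB.instance Definition _ := isUMagmaMorphism.Build G quot quot_proj (erefl, quot_proj_morph).

Lemma finite_quot_index : finite_set [set: quot] -> finite_index N.
Proof.
move=> fin; apply: sub_finite_set (finite_image (fun a => left_coset N (repr a)) fin).
move=> _ [x _ <-]; exists (\pi_quot x) => //.
have xx := repr_cong x.
rewrite /left_coset; apply/seteqP; split=> _ [h Nh <-].
  exists (((repr (\pi_quot x))^-1 * x)^-1 * h); first exact/NM/Nh/NV.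
  by rewrite invgM invgK !mulgA mulgV mul1g.
exists ((repr (\pi_quot x))^-1 * x * h); first exact: NM.
by rewrite !mulgA mulgV mul1g.
Qed.

(** Schur's theorem in the quotient by N, stated without the quotient. *)
Theorem finite_index_central_perfect (F : finType) (f : G -> F) :
  (forall x y z, f x = f y -> N [~ x^-1 * y, z]) ->
  (forall x, exists s : seq (G * G), x = \prod_(p <- s) [~ p.1, p.2]) ->
  finite_index N.
Proof.
move=> fC perf; apply: finite_quot_index.
apply: (@schur_finite _ _ (fun a : quot => f (repr a))) => [a b c /fC H|a].
  have {}H : quot_proj 1 = quot_proj [~ (repr a)^-1 * repr b, repr c].
    by apply/quot_projE; rewrite invg1 mul1g.
  have K (d : quot) : quot_proj (repr d) = d by exact: reprK.
  by move: H; rewrite gmulf1 gmulfR gmulfM gmulfV /= !K => /esym/eqP/commgP.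
have [s e] := perf (repr a); exists [seq (quot_proj p.1, quot_proj p.2) | p <- s].
have -> : a = quot_proj (repr a) by rewrite /quot_proj reprK.
rewrite big_map {1}e gmulf_prod.
by apply: eq_bigr => p _; rewrite gmulfR.
Qed.
End Quotient.

(** * The special linear group over the integers is generated by elementary matrices *)

(** Both sides are the determinant of one bordered matrix, factored through either
    Schur complement. *)
Lemma det_transv (R : comNzRingType) n (x : 'cV[R]_n) (y : 'rV[R]_n) :
  y *m x = 0 -> \det (1%:M + x *m y) = 1.
Proof.
move=> yx; transitivity (\det (block_mx 1%:M (- y) x 1%:M : 'M_(1 + n))).
  have -> : block_mx 1%:M (- y) x 1%:M =
      block_mx 1%:M 0 x 1%:M *m block_mx 1%:M (- y) 0 (1%:M + x *m y) :> 'M_(1 + n).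
    by rewrite mulmx_block !mul1mx !mul0mx !mulmx1 !addr0 mulmxN addrC addrK.
  by rewrite det_mulmx det_lblock det_ublock !det1 !mul1r.
have -> : block_mx 1%:M (- y) x 1%:M =
    block_mx 1%:M (- y) 0 1%:M *m block_mx 1%:M 0 x 1%:M :> 'M_(1 + n).
  by rewrite mulmx_block !mul1mx !mul0mx !mulmx1 !add0r mulNmx yx subr0 ?addr0.
by rewrite det_mulmx det_lblock det_ublock !det1 !mul1r.
Qed.

Section ElementaryGeneration.
Variables (n : nat) (P : 'M[int]_n -> Prop).
Hypothesis cP : mul_closed P.
Hypothesis Pij : forall i j t, i != j -> transv_in P (ecol int i) (t *: erow int j).
Implicit Types (x : 'cV[int]_n).
Variable k : 'I_n.

(** The orbit of the basis column e_k, in the form in which the matrix that carries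
    e_k to x can be split off from a matrix having x as a column. *)
Definition reachable x := exists E, [/\ P E, \det E = 1 & x = E *m ecol int k].

Lemma elementary_cancel x i j t : i != j ->
  (1%:M + ecol int i *m (- t *: erow int j)) *m (x + (t * x j 0) *: ecol int i) = x.
Proof.
move=> ij; rewrite mulmxDl mul1mx -mulmxA -scalemxAl mulmxDr -!scalemxAr.
rewrite erow_ecol eq_sym (negPf ij) erow_mul_col raddf0 scaler0 addr0.
by rewrite mul_mx_scalar scalerA -addrA -scalerDl mulNr subrr scale0r addr0.
Qed.

Lemma reachable_add x i j t : i != j ->
  reachable (x + (t * x j 0) *: ecol int i) -> reachable x.
Proof.
move=> ij [E [PE dE eE]].
have [yx PT] := Pij (- t) ij.
exists ((1%:M + ecol int i *m (- t *: erow int j)) *m E); split.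
- exact: cP.2.
- by rewrite det_mulmx dE det_transv.
by rewrite -mulmxA -eE elementary_cancel.
Qed.

Lemma reachable_self : reachable (ecol int k).
Proof. by exists 1%:M; split; [exact: cP.1 | exact: det1 | rewrite mul1mx]. Qed.

Lemma ecolE (i j : 'I_n) : ecol int i j 0 = (j == i)%:R.
Proof. by rewrite mxE eqxx andbT. Qed.

(** The sign is absorbed by passing through c e_i + e_k, since c * c = 1. *)
Lemma reachable_sign i (c : int) : i != k -> c * c = 1 -> reachable (c *: ecol int i).
Proof.
move=> ik cc; apply: (@reachable_add _ k i c); first by rewrite eq_sym.
rewrite [X in c * X]mxE ecolE eqxx mulr1 cc scale1r.
apply: (@reachable_add _ i k (- c)) => //.
rewrite 2!mxE !ecolE [k == i]eq_sym (negPf ik) eqxx mulr0 add0r mulr1.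
by rewrite scaleNr addrAC subrr add0r; exact: reachable_self.
Qed.

(** Euclid's algorithm: as long as two entries are nonzero, adding or subtracting
    the smaller one decreases the sum of absolute values. A unimodular column with a
    single nonzero entry is a signed basis vector. The index l provides room to
    turn - e_k into e_k. *)
Lemma reachable_unimodular l x (z : 'rV[int]_n) :
  l != k -> z *m x = 1%:M -> reachable x.
Proof.
move=> lk; move: {2}(\sum_i `|x i 0%R|)%N.+1 (ltnSn (\sum_i `|x i 0%R|)%N) => m.
elim: m x z => // m IH x z xm zx.
have step i j : i != j -> x i 0 != 0 -> (`|x i 0%R| <= `|x j 0%R|)%N -> reachable x.
  move=> ij xi0 xij.
  have [t xt] : exists t : int, (`|(x j 0 + t * x i 0)%R| < `|x j 0%R|)%N.
    have [s|s] := boolP ((0 <= x i 0) == (0 <= x j 0)); [exists (-1) | exists 1].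
      by move: xi0 xij s; rewrite mulN1r; lia.
    by move: xi0 xij s; rewrite mul1r; lia.
  apply: (@reachable_add _ j i t); first by rewrite eq_sym.
  apply: (IH _ (z *m (1%:M + ecol int j *m (- t *: erow int i)))).
    rewrite -ltnS; apply: leq_trans xm; rewrite ltnS (bigD1 j) //=.
    rewrite [in X in (_ < X)%N](bigD1 j) //=.
    rewrite !mxE eqxx mulr1 -addSn leq_add // leq_sum // => i' i'j.
    by rewrite !mxE (negPf i'j) mulr0 addr0.
  by rewrite -mulmxA elementary_cancel // eq_sym.
have [i xi0] : exists i, x i 0 != 0.
  apply: contrapT => H; suff x0 : x = 0.
    by move: zx => /(congr1 (fun A : 'M[int]_1 => A 0 0)); rewrite x0 mulmx0 !mxE.
  apply/matrixP => i j; rewrite ord1 mxE; have [//|xi] := eqVneq (x i 0) 0.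
  by case: H; exists i.
have [[j ji xj0]|] := pselect (exists2 j, j != i & x j 0 != 0).
  have [ij|/ltnW] := leqP `|x i 0%R|%N `|x j 0%R|%N; first by apply: (step i j); rewrite // eq_sym.
  exact: step.
move=> H; have xE : x = x i 0 *: ecol int i.
  rewrite {1}(cV_sum_ecol x) (bigD1 i) //= big1 ?addr0 // => j ji.
  have [->|xj0] := eqVneq (x j 0) 0; first by rewrite scale0r.
  by case: H; exists j.
have xx : x i 0 * x i 0 = 1.
  move: zx; rewrite {1}xE -scalemxAr row_mul_ecol => /(congr1 (fun A : 'M[int]_1 => A 0 0)).
  rewrite !mxE eqxx !mulr1n.
  move: (x i 0) (z 0 i) => a b /(congr1 absz)/eqP.
  by rewrite abszM muln_eq1 => /andP[/eqP a1 _]; move: a1; clear; lia.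
have [ik|ik] := eqVneq i k; last by rewrite xE; exact: reachable_sign.
have [x1|x1] : x i 0 = 1 \/ x i 0 = -1 by
  move/eqP: xx; rewrite -expr2 sqrf_eq1 => /orP[/eqP|/eqP]; [left | right].
  by rewrite xE x1 ik scale1r; exact: reachable_self.
rewrite xE x1 ik scaleN1r; apply: (@reachable_add _ l k (-1)) => //.
rewrite mxE ecolE eqxx mulrNN mulr1 scale1r.
apply: (@reachable_add _ k l 1); first by rewrite eq_sym.
rewrite 2!mxE !ecolE eqxx (negPf lk) oppr0 add0r mulr1 scale1r addrAC addNr add0r.
by rewrite -[ecol int l]scale1r; exact: reachable_sign.
Qed.
End ElementaryGeneration.

(** Induction on the dimension: once the first column is a basis column, the matrix is
    the product of a smaller block and a transvection along the first row. *)
Theorem elementary_generation n (P : 'M[int]_n -> Prop) : mul_closed P ->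
  (forall i j t, i != j -> transv_in P (ecol int i) (t *: erow int j)) ->
  forall A, \det A = 1 -> P A.
Proof.
elim: n P => [|n IH] P cP Pij A dA.
  by have -> : A = 1%:M; [apply/matrixP => -[] | case: cP].
case: n => [|n] in IH P cP Pij A dA *.
  suff -> : A = 1%:M by case: cP.
  by rewrite [A]mx11_scalar -det_mx11 dA.
have zx : row ord0 (invmx A) *m col ord0 A = 1%:M.
  rewrite -row_mul colE mulmxA mulVmx ?unitmxE ?dA // mul1mx.
  by apply/matrixP => i j; rewrite !ord1 !mxE.
have [E [PE dE eE]] := reachable_unimodular cP Pij (isT : lift ord0 ord0 != ord0 :> 'I_n.+2) zx.
have uE : E \in unitmx by rewrite unitmxE dE.
have [B [eA eB dB]] : exists B : 'M[int]_(1 + n.+1),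
    [/\ A = E *m B, (forall i, B i (lshift _ 0) = (i == lshift _ 0)%:R) & \det B = 1].
  exists (invmx E *m A); split; first by rewrite mulKVmx.
  2: by rewrite det_mulmx det_inv dE invr1 mul1r.
  have : col ord0 (invmx E *m A) = ecol int ord0 by rewrite colE -mulmxA -colE eE mulKmx.
  have -> : lshift n.+1 (0 : 'I_1) = ord0 :> 'I_n.+2 by exact: ord_inj.
  move=> H i; have := congr1 (fun v : 'cV[int]_n.+2 => v i 0) H.
  by rewrite [LHS]mxE => ->; rewrite mxE eqxx andbT.
have Bb : B = block_mx 1%:M (ursubmx B) 0 (drsubmx B).
  rewrite -{1}[B]submxK; congr block_mx; apply/matrixP => i j.
    by rewrite !mxE !ord1 eB eqxx.
  by rewrite !mxE ord1 eB eq_rlshift.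
rewrite eA; apply: cP.2 => //.
pose Q (D : 'M[int]_n.+1) := P (block_mx (1%:M : 'M_1) 0 0 D).
have Q1 : mul_closed Q.
  split=> [|C D PC PD]; first by rewrite /Q -scalar_mx_block; exact: cP.1.
  have e : block_mx (1%:M : 'M_1) 0 0 C *m block_mx 1%:M 0 0 D = block_mx 1%:M 0 0 (C *m D).
    by rewrite mulmx_block !(mulmx0, mul0mx, mul1mx, add0r, addr0).
  by rewrite /Q -e; exact: cP.2.
have QD : Q (drsubmx B).
  apply: (IH Q) => // [i j t ij|]; last first.
    by move: dB; rewrite Bb det_ublock det1 mul1r block_mxKdr.
  split; first by rewrite -scalemxAl erow_ecol eq_sym (negPf ij) raddf0 scaler0.
  have [_] := Pij (rshift 1 i) (rshift 1 j) t (contra_neq (@rshift_inj 1 n.+1 i j) ij).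
  have e : block_mx (1%:M : 'M_1) 0 0 (1%:M + ecol int i *m (t *: erow int j)) =
      1%:M + ecol int (rshift 1 i) *m (t *: erow int (rshift 1 j)).
    rewrite /ecol /erow delta_mx_dshift delta_mx_rshift scale_row_mx mul_col_row.
    by rewrite scalar_mx_block add_block_mx !(mul0mx, scaler0, mulmx0) !addr0.
  by rewrite /Q e.
have -> : B = block_mx 1%:M 0 0 (drsubmx B) *m
    (1%:M + ecol int (lshift n.+1 0) *m row_mx 0 (ursubmx B)).
  rewrite /ecol delta_mx_ushift mul_col_row scalar_mx_block add_block_mx.
  rewrite !(mul0mx, mulmx0, addr0, add0r) mulmx_block.
  rewrite !(mul0mx, mulmx0, addr0, add0r, mulmx1, mul1mx) {1}Bb.
  by congr block_mx; rewrite [delta_mx _ _](_ : _ = 1%:M) ?mul1mx //;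
     apply/matrixP => a b; rewrite !mxE !ord1.
pose k0 : 'I_n.+2 := lshift n.+1 (0 : 'I_1).
pose b : 'rV[int]_n.+2 := row_mx (0 : 'M_1) (ursubmx B).
suff [_ Pb] : transv_in P (ecol int k0) b by apply: cP.2.
rewrite (rV_sum_erow b); apply: transv_in_sumr => // i _; have [->|i0] := eqVneq i k0.
  have -> : b 0 k0 = 0 by rewrite [LHS](row_mxEl (0 : 'M_1)) mxE.
  by rewrite scale0r; exact: transv_in0r.
by apply: Pij; rewrite eq_sym.
Qed.

(** * Relative elementary subgroups have finite index *)

(** The witness t is the part of a made of the primes that do not divide b. A prime
    divisor of a then divides exactly one of b and t, hence not b + t c, given that
    it cannot divide b and c both. *)
Lemma bezout_shift (a b c p r s : int) : a != 0 -> p * a + r * b + s * c = 1 ->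
  exists t u v, u * a + v * (b + t * c) = 1.
Proof.
move=> a0 bez; pose pi := [pred l : nat | ~~ (l %| `|b|)%N].
have A0 : (0 < `|a|)%N by rewrite absz_gt0.
pose t : nat := (`|a|%N)`_pi; exists t%:Z.
suff : coprimez a (b + t%:Z * c).
  by case/coprimezP=> -[u v] /= e; exists u, v.
rewrite /coprimez /gcdz; apply/negPn/negP => g1.
set g := gcdn _ _ in g1.
have pr : prime (pdiv g).
  apply: pdiv_prime; rewrite ltn_neqAle eq_sym gcdn_gt0 A0 andbT; exact: g1.
move: (pdiv g) (pdiv_dvd g) pr => l lg pr.
have la : (l%:Z %| a)%Z by rewrite dvdzE; exact: dvdn_trans lg (dvdn_gcdl _ _).
have lb : (l%:Z %| b + t%:Z * c)%Z by rewrite dvdzE; exact: dvdn_trans lg (dvdn_gcdr _ _).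
have lt : (l %| t)%N = ~~ (l %| `|b|)%N.
  have := pi_of_part pi A0 l; rewrite !inE !mem_primes pr part_gt0 A0 /= => ->.
  by rewrite (dvdzE l%:Z) /= in la; rewrite la.
have [lbb|lbb] := boolP (l%:Z %| b)%Z.
  move: lb; rewrite rpredDl //.
  rewrite dvdzE abszM Euclid_dvdM // [(_ %| `|t%:Z|)%N]lt; rewrite dvdzE /= in lbb.
  rewrite lbb /= => lc.
  have : ((p * a + r * b + s * c)%R \in dvdz l%:Z).
    by apply: rpredD; [apply: rpredD|]; apply: dvdz_mull; rewrite // dvdzE.
  by rewrite bez dvdz1; case: (l) pr => [|[]].
have ltc : t%:Z * c \in dvdz l%:Z by apply: dvdz_mulr; rewrite dvdzE /= lt.
by case/negP: lbb; move: lb; rewrite (rpredDr _ ltc).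
Qed.

Section Generated.
Variable G : groupType.
Implicit Types S H : set G.

Lemma generated_subgroup S : subgroup (generated S).
Proof.
split=> [H [[]] //|x y Sx Sy H HS|x Sx H HS].
  by case: (HS.1) => _ HM _; apply: HM; [apply: Sx | apply: Sy].
by case: (HS.1) => _ _ HV; apply: HV; apply: Sx.
Qed.

Lemma sub_generated S : S `<=` generated S.
Proof. by move=> x Sx H [_]; apply. Qed.

Lemma generated_min S H : subgroup H -> S `<=` H -> generated S `<=` H.
Proof. by move=> sH SH x; apply. Qed.

Lemma subgroupX H x n : subgroup H -> H x -> H (x ^+ n)%g.
Proof.
by case=> H1 HM _ Hx; elim: n => // n IH; rewrite expgS; apply: HM.
Qed.

Lemma finite_index_sub (N H : set G) : N 1%g -> subgroup H -> N `<=` H ->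
  finite_index N -> finite_index H.
Proof.
move=> N1 [H1 HM HV] NH fN.
pose sat (A : set G) : set G := [set p.1 * p.2 | p in A `*` H]%g.
apply: sub_finite_set (finite_image sat fN) => _ [x _ <-].
exists (left_coset N x); first by exists x.
apply/seteqP; split=> [_ [[a h] /= [[m Nm <-] Hh] <-]|_ [h Hh <-]].
  by exists (m * h)%g; [apply: HM => //; exact: NH | rewrite mulgA].
exists (x, h) => //; split=> //; exists 1%g; rewrite ?mulg1 //.
Qed.
End Generated.

Section SLTransvections.
Variables (R : comUnitRingType) (n : nat).
Implicit Types (g h : SL R n) (x : 'cV[R]_n) (y : 'rV[R]_n) (H : set (SL R n)).

Lemma val_SLM g h : val (g * h)%g = val g *m val h. Proof. by []. Qed.
Lemma val_SLV g : val (g^-1)%g = invmx (val g). Proof. by []. Qed.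
Lemma val_SL1 : val (1%g : SL R n) = 1%:M. Proof. by []. Qed.

Definition matrices_of H (A : 'M[R]_n) : Prop := exists2 h, H h & val h = A.

Lemma matrices_of_mul_closed H : subgroup H -> mul_closed (matrices_of H).
Proof.
move=> [H1 HM _]; split; first by exists 1%g.
by move=> _ _ [g Hg <-] [h Hh <-]; exists (g * h)%g; first exact: HM.
Qed.

(** Total in x and y; meaningful when y *m x = 0 (val_transvection). *)
Definition transvection x y : SL R n := insubd (1%g : SL R n) (1%:M + x *m y).

Lemma val_transvection x y : y *m x = 0 -> val (transvection x y) = 1%:M + x *m y.
Proof. by move=> yx; rewrite insubdK // unfold_in det_transv. Qed.

Lemma matrices_of_transvection H x y :
  transv_in (matrices_of H) x y <-> y *m x = 0 /\ H (transvection x y).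
Proof.
split=> -[yx]; last by move=> Ht; split=> //; exists (transvection x y); rewrite ?val_transvection.
move=> [h Hh e]; split=> //; suff <- : h = transvection x y by [].
by apply: val_inj; rewrite val_transvection.
Qed.

Lemma transvectionC c x y : transvection (c *: x) y = transvection x (c *: y).
Proof. by rewrite /transvection -scalemxAl -scalemxAr. Qed.

Lemma transvectionM x x' y : y *m x = 0 -> y *m x' = 0 ->
  (transvection x y * transvection x' y)%g = transvection (x + x') y.
Proof.
move=> yx yx'; have yxx : y *m (x + x') = 0 by rewrite mulmxDr yx yx' addr0.
apply: val_inj; rewrite val_SLM !val_transvection //.
by rewrite transv_mul // mulmxDl.
Qed.

Lemma transvectionMr x y y' : y *m x = 0 -> y' *m x = 0 ->
  (transvection x y * transvection x y')%g = transvection x (y + y').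
Proof.
move=> yx yx'; have yyx : (y + y') *m x = 0 by rewrite mulmxDl yx yx' addr0.
apply: val_inj; rewrite val_SLM !val_transvection //.
by rewrite transv_mul // mulmxDr.
Qed.

Lemma transvectionV x y : y *m x = 0 -> ((transvection x y)^-1 = transvection (- x) y)%g.
Proof.
move=> yx; apply: (mulgI (transvection x y)); rewrite mulgV; apply: val_inj.
rewrite val_SLM !val_transvection ?mulmxN ?yx ?oppr0 // transv_mul ?mulmxN ?yx ?oppr0 //.
by rewrite mulNmx subrr addr0.
Qed.

Lemma transvectionJ x y g : y *m x = 0 ->
  (transvection x y ^ g = transvection (invmx (val g) *m x) (y *m val g))%g.
Proof.
move=> yx; apply: val_inj.
rewrite conjgE !val_SLM val_SLV !val_transvection //.
  by rewrite mulmxDl mul1mx mulmxDr mulVmx ?SL_unitmx // !mulmxA.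
by rewrite mulmxA mulmxK ?SL_unitmx.
Qed.

Lemma transvection_comm x y x' y' : y *m x = 0 -> y' *m x' = 0 -> y' *m x = 0 ->
  [~ transvection (- x) y, transvection (- x') y']%g = transvection ((y *m x') 0 0 *: x) y'.
Proof.
move=> yx yx' yx0.
apply: val_inj; rewrite commgEl conjgE -!transvectionV // !invgK !val_SLM !transvectionV //.
rewrite !val_transvection ?mulmxN ?yx ?yx' ?oppr0 //; last first.
  by rewrite -scalemxAr yx0 scaler0.
by rewrite !mulmxA transv_commutator.
Qed.
End SLTransvections.

Section CentralModulo.
Local Open Scope group_scope.
Variables (G : groupType) (N : set G) (nN : normal_subgroup N).
Let NM x y : N x -> N y -> N (x * y). Proof. case: nN => [[_ H _] _]; exact: H. Qed.
Let NV x : N x -> N x^-1. Proof. case: nN => [[_ _ H] _]; exact: H. Qed.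
Let NJ x y : N x -> N (x ^ y). Proof. case: nN => [_ H]; exact: H. Qed.

Definition central_mod (g : G) := forall z, N [~ g, z].

Lemma commMg_conj (x y z : G) : [~ x * y, z] = [~ x, z] ^ y * [~ y, z].
Proof. by rewrite !commgEl !conjgE !invgM -!mulgA !mulVKg. Qed.

Lemma commgM_conj (x y z : G) : [~ x, y * z] = [~ x, z] * [~ x, y] ^ z.
Proof. by rewrite !commgEl !conjgE !invgM -!mulgA !mulVKg. Qed.

Lemma commg_normal a z : N a -> N [~ a, z].
Proof. by move=> Na; rewrite commgEl; apply: NM; [exact: NV | exact: NJ]. Qed.

Lemma central_mod_mull a g : N a -> central_mod (a * g) -> central_mod g.
Proof.
move=> Na C z; have -> : g = a^-1 * (a * g) by rewrite mulKg.
by rewrite commMg_conj; apply: NM; [apply/NJ/commg_normal/NV | exact: C].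
Qed.

Lemma central_mod_mulr a g : N a -> central_mod (g * a) -> central_mod g.
Proof.
move=> Na C z; have -> : g = g * a * a^-1 by rewrite mulgK.
by rewrite commMg_conj; apply: NM; [exact/NJ/C | apply/commg_normal/NV].
Qed.

Lemma central_modJ g w : central_mod (g ^ w) -> central_mod g.
Proof. by move=> C z; rewrite -[[~ g, z]](conjgK w) conjRg; apply/NJ/C. Qed.

Lemma commg_mul_closed g z w : N [~ g, z] -> N [~ g, w] -> N [~ g, z * w].
Proof. by move=> Nz Nw; rewrite commgM_conj; apply: NM => //; exact: NJ. Qed.

Lemma commg_inv_closed g z : N [~ g, z] -> N [~ g, z^-1].
Proof.
move=> Nz; have -> : [~ g, z^-1] = [~ g, z]^-1 ^ z^-1.
  by rewrite invgR !commgEl !conjgE !invgK -!mulgA !mulVKg.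
exact/NJ/NV.
Qed.

Lemma commg_comm_closed g z w : N [~ g, z] -> N [~ g, w] -> N [~ g, [~ z, w]].
Proof.
move=> Nz Nw; rewrite commgEl conjgE.
by do ![apply: commg_mul_closed => // | apply: commg_inv_closed => //].
Qed.
End CentralModulo.

Section CongruenceKernel.
Variables (n : nat) (q : int).
Hypothesis q1 : 1 < q.
Local Notation G := (SL int n).
Implicit Types (g h : G) (x : 'cV[int]_n) (y z : 'rV[int]_n).

(** With x a basis column this contains the elementary matrices with entries
    in q Z. Allowing every unimodular x makes the set stable under conjugation, so
    that the group it generates is the normal closure of those matrices. *)
Definition congruence_transvections : set G :=
  [set h | exists x y (z : 'rV[int]_n),
    [/\ y *m x = 0, z *m x = 1%:M & h = transvection x (q *: y)]].

Definition relative_elementary : set G := generated congruence_transvections.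
Local Notation N := relative_elementary.

Lemma relative_elementary_normal : normal_subgroup N.
Proof.
split=> [|g h Ng]; first exact: generated_subgroup.
pose S := [set k : G | N (k ^ h)%g]; suff : N `<=` S by apply.
have [N1 NM NV] := generated_subgroup congruence_transvections.
apply: generated_min => [|k [x [y [z [yx zx ->]]]]].
  split=> [|a b Sa Sb|a Sa]; rewrite /S /= ?conj1g ?conjMg ?conjVg //.
    exact: NM.
  exact: NV.
apply: sub_generated; exists (invmx (val h) *m x), (y *m val h), (z *m val h).
have E (v : 'rV[int]_n) : v *m val h *m (invmx (val h) *m x) = v *m x.
  by rewrite mulmxA mulmxK ?SL_unitmx.
split; rewrite ?E // transvectionJ -?scalemxAl ?yx ?scaler0 //.
Qed.
Let nN := relative_elementary_normal.
Let cN : mul_closed (matrices_of N) := matrices_of_mul_closed nN.1.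

Lemma relative_elementary_transv x y z : y *m x = 0 -> z *m x = 1%:M ->
  transv_in (matrices_of N) x (q *: y).
Proof.
move=> yx zx; apply/matrices_of_transvection; rewrite -scalemxAl yx scaler0; split=> //.
by apply: sub_generated; exists x, y, z.
Qed.

Lemma relative_elementary_row k y : y 0 k = 0 ->
  transv_in (matrices_of N) (ecol int k) (q *: y).
Proof.
move=> yk; apply: (@relative_elementary_transv _ _ (erow int k)); last by rewrite erow_ecol eqxx.
by rewrite row_mul_ecol yk raddf0.
Qed.

Lemma relative_elementary_col k x : x k 0 = 0 ->
  transv_in (matrices_of N) (q *: x) (erow int k).
Proof.
move=> xk; rewrite (cV_sum_ecol x) scaler_sumr; apply: transv_in_suml => // i _.
have [->|ik] := eqVneq i k; first by rewrite xk scale0r scaler0; exact: transv_in0l.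
rewrite scalerA; apply/transv_inC; rewrite -scalerA; apply: relative_elementary_row.
by rewrite !mxE eqxx (negPf ik) mulr0.
Qed.

Definition congruent g := exists M, val g = 1%:M + q *: M.

Lemma congruentM g h : congruent g -> congruent h -> congruent (g * h)%g.
Proof.
move=> [A eA] [B eB]; exists (A + B + q *: (A *m B)).
rewrite val_SLM eA eB mulmxDl !mulmxDr !mul1mx !mulmx1 -scalemxAl -!scalemxAr.
by rewrite -!addrA; congr (_ + _); rewrite !scalerDr addrCA addrA.
Qed.

Lemma congruentJ g h : congruent g -> congruent (g ^ h)%g.
Proof.
move=> [A eA]; exists (invmx (val h) *m A *m val h).
rewrite conjgE !val_SLM val_SLV eA mulmxDl mulmxDr mul1mx mulVmx ?SL_unitmx //.
by rewrite -scalemxAl -scalemxAr mulmxA.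
Qed.

Lemma congruent_transvection x y : (q *: y) *m x = 0 -> congruent (transvection x (q *: y)).
Proof. by move=> yx; exists (x *m y); rewrite val_transvection // -scalemxAr. Qed.

Let q0 : q != 0. Proof. by move: q1; clear; lia. Qed.

(** The elementary matrices in row and column k generate all others, by
    e_ij = [e_ik, e_kj]. *)
Lemma central_of_cross g k :
  (forall i t, i != k -> N [~ g, transvection (t *: ecol int i) (erow int k)]%g) ->
  (forall j t, j != k -> N [~ g, transvection (ecol int k) (t *: erow int j)]%g) ->
  central_mod N g.
Proof.
move=> Nik Nkj z; pose P (A : 'M[int]_n) := exists2 z : G, N [~ g, z]%g & val z = A.
suff [w Nw /val_inj <- //] : P (val z).
apply: elementary_generation; last exact/eqP/(valP z).
  split=> [|_ _ [a Na <-] [b Nb <-]]; first by exists 1%g; rewrite ?commg1 //; case: nN.1.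
  by exists (a * b)%g => //; exact: (commg_mul_closed nN).
move=> i j t ij.
have ji0 : t *: erow int j *m ecol int i = 0.
  by rewrite -scalemxAl erow_ecol eq_sym (negPf ij) raddf0 scaler0.
split=> //; exists (transvection (ecol int i) (t *: erow int j)); rewrite ?val_transvection //.
have [jk|jk] := eqVneq j k.
  by rewrite jk -transvectionC; apply: Nik; rewrite -jk.
have [->|ik] := eqVneq i k; first exact: Nkj.
have ki0 : erow int k *m ecol int i = 0 by rewrite erow_ecol eq_sym (negPf ik) raddf0.
have jk0 : t *: erow int j *m ecol int k = 0.
  by rewrite -scalemxAl erow_ecol (negPf jk) raddf0 scaler0.
have := transvection_comm ki0 jk0 ji0.
rewrite erow_ecol eqxx mxE mulr1n scale1r => <-; apply: (commg_comm_closed nN).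
  by rewrite -scaleN1r; apply: Nik.
by rewrite -scaleN1r transvectionC scalerA; apply: Nkj.
Qed.

(** For z = 1 + t e_i e_k the commutator of g and z is 1 + t (e_i - g^-1 e_i) e_k,
    because g fixes the row e_k; its entries are divisible by q and it is concentrated
    in column k. The row case is symmetric. *)
Lemma central_fixed_cross g k : congruent g ->
  val g *m ecol int k = ecol int k -> erow int k *m val g = erow int k ->
  central_mod N g.
Proof.
move=> [M eM] gk kg.
have Mk : M *m ecol int k = 0.
  move: gk; rewrite eM mulmxDl mul1mx => /(canRL (addKr _)); rewrite addNr -scalemxAl.
  by move/eqP; rewrite scalemx_eq0 (negPf q0) => /eqP.
have kM : erow int k *m M = 0.
  move: kg; rewrite eM mulmxDr mulmx1 => /(canRL (addKr _)); rewrite addNr -scalemxAr.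
  by move/eqP; rewrite scalemx_eq0 (negPf q0) => /eqP.
have gVk : invmx (val g) *m ecol int k = ecol int k by rewrite -{1}gk mulKmx ?SL_unitmx.
have kgV : erow int k *m invmx (val g) = erow int k by rewrite -{1}kg mulmxK ?SL_unitmx.
apply: (@central_of_cross g k) => [i t ik|j t jk].
  have ki0 : erow int k *m ecol int i = 0 by rewrite erow_ecol eq_sym (negPf ik) raddf0.
  have kti0 : erow int k *m (t *: ecol int i) = 0 by rewrite -scalemxAr ki0 scaler0.
  rewrite commgEr transvectionV // transvectionJ ?mulmxN ?kti0 ?oppr0 // kg.
  rewrite transvectionM ?mulmxN ?mulmxA ?kgV ?kti0 ?oppr0 //.
  suff /matrices_of_transvection[] : transv_in (matrices_of N)
    (- (invmx (val g) *m (t *: ecol int i)) + t *: ecol int i) (erow int k) by [].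
  have -> : - (invmx (val g) *m (t *: ecol int i)) + t *: ecol int i =
      q *: (invmx (val g) *m (M *m (t *: ecol int i))).
    rewrite scalemxAr scalemxAl -[q *: M](addKr 1%:M) -eM mulmxDl mulNmx mul1mx.
    by rewrite mulmxDr mulmxN mulKmx ?SL_unitmx.
  apply: relative_elementary_col.
  have : erow int k *m (invmx (val g) *m (M *m (t *: ecol int i))) = 0.
    by rewrite mulmxA kgV mulmxA kM mul0mx.
  by rewrite erow_mul_col => /(congr1 (fun A : 'M[int]_1 => A 0 0)); rewrite !mxE eqxx mulr1n.
have jk0 : t *: erow int j *m ecol int k = 0.
  by rewrite -scalemxAl erow_ecol (negPf jk) raddf0 scaler0.
have gjk0 : - (t *: erow int j *m val g) *m ecol int k = 0.
  by rewrite mulNmx -mulmxA gk jk0 oppr0.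
rewrite commgEr transvectionV // transvectionJ ?mulmxN ?jk0 ?oppr0 // gVk.
rewrite -scaleN1r transvectionC scaleN1r transvectionMr //.
suff /matrices_of_transvection[] : transv_in (matrices_of N) (ecol int k)
    (- (t *: erow int j *m val g) + t *: erow int j) by [].
have -> : - (t *: erow int j *m val g) + t *: erow int j = q *: - (t *: erow int j *m M).
  by rewrite eM mulmxDr mulmx1 opprD addrAC addNr add0r -scalemxAr scalerN.
apply: relative_elementary_row; have : - (t *: erow int j *m M) *m ecol int k = 0.
  by rewrite mulNmx -mulmxA Mk mulmx0 oppr0.
by rewrite row_mul_ecol => /(congr1 (fun A : 'M[int]_1 => A 0 0)); rewrite !mxE eqxx mulr1n.
Qed.

Lemma relative_elementary_transvection x y : transv_in (matrices_of N) x y -> N (transvection x y).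
Proof. by case/matrices_of_transvection. Qed.

(** Row k is cleared by a transvection along it; its entries off the diagonal are
    divisible by q. *)
Lemma central_fixed_col g k : congruent g ->
  val g *m ecol int k = ecol int k -> central_mod N g.
Proof.
move=> [M eM] gk.
have Mk : M *m ecol int k = 0.
  move: gk; rewrite eM mulmxDl mul1mx => /(canRL (addKr _)); rewrite addNr -scalemxAl.
  by move/eqP; rewrite scalemx_eq0 (negPf q0) => /eqP.
pose y : 'rV[int]_n := - (erow int k *m M).
have yk : y *m ecol int k = 0 by rewrite mulNmx -mulmxA Mk mulmx0 oppr0.
have qyk : q *: y *m ecol int k = 0 by rewrite -scalemxAl yk scaler0.
have y0k : y 0 k = 0.
  move: yk; rewrite row_mul_ecol => /(congr1 (fun A : 'M[int]_1 => A 0 0)).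
  by rewrite !mxE eqxx mulr1n.
have Na := relative_elementary_transvection (relative_elementary_row y0k).
apply: (central_mod_mulr nN Na); apply: (@central_fixed_cross _ k).
- by apply: congruentM; [exists M | exact: congruent_transvection].
- by rewrite val_SLM val_transvection // -mulmxA mulmxDl mul1mx -mulmxA qyk mulmx0 addr0.
have -> : val (g * transvection (ecol int k) (q *: y))%g = 1%:M + q *: M + ecol int k *m (q *: y).
  rewrite val_SLM val_transvection // eM mulmxDr mulmx1; congr (_ + _).
  by rewrite mulmxDl mul1mx mulmxA -scalemxAl Mk scaler0 mul0mx addr0.
rewrite !mulmxDr mulmx1 mulmxA erow_ecol eqxx mul1mx -scalemxAr /y scalerN -addrA subrr.
exact: addr0.
Qed.

(** Column k is cleared by a transvection along it. *)
Lemma central_diag1 g k : congruent g -> val g k k = 1 -> central_mod N g.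
Proof.
move=> cg gkk; have [M eM] := cg.
have Mkk : M k k = 0.
  move: gkk; rewrite eM !mxE eqxx => /(canRL (addKr _)); rewrite addNr => /eqP.
  by rewrite mulf_eq0 (negPf q0) => /eqP.
pose x : 'cV[int]_n := - (M *m ecol int k).
have xk : x k 0 = 0 by rewrite mxE -colE mxE Mkk oppr0.
have [kx Nh] := proj1 (matrices_of_transvection _ _ _) (relative_elementary_col xk).
apply: (central_mod_mull nN Nh); apply: (@central_fixed_col _ k).
  by apply: congruentM => //; exists (x *m erow int k); rewrite val_transvection // -scalemxAl.
rewrite val_SLM val_transvection // -mulmxA mulmxDl mul1mx -mulmxA.
have -> : erow int k *m (val g *m ecol int k) = 1%:M by rewrite erow_mul_col -colE mxE gkk.
by rewrite mulmx1 eM mulmxDl mul1mx -scalemxAl -addrA /x scalerN subrr addr0.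
Qed.

(** As entries k and i of column k are coprime, a multiple of q may be added to
    entry j to make it 1 - g_kk. Conjugating by 1 - e_k e_j, which is not
    congruent to 1 modulo q, then adds it to the diagonal entry, which becomes 1. *)
Lemma central_coprime_entries g k i j u v : congruent g ->
  i != k -> j != k -> i != j -> u * val g k k + v * val g i k = 1 -> central_mod N g.
Proof.
move=> cg ik jk ij uv; have [M eM] := cg.
pose s := - M k k - M j k.
have es : q * s = 1 - val g k k - val g j k.
  by rewrite eM !mxE eqxx (negPf jk) mulr1n mulr0n /s; ring.
pose y : 'rV[int]_n := s *: (u *: erow int k + v *: erow int i).
have yj : y 0 j = 0 by rewrite !mxE !eqxx (negPf jk) [j == i]eq_sym (negPf ij) !mulr0.
have [yj0 Nh] := proj1 (matrices_of_transvection _ _ _) (relative_elementary_row yj).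
apply: (central_mod_mull nN Nh); set g2 := (_ * g)%g.
have kj0 : erow int j *m - ecol int k = 0.
  by rewrite mulmxN erow_ecol (negPf jk) raddf0 oppr0.
have cg2 : congruent g2 by apply/congruentM => //; exact: congruent_transvection.
have gk : val g2 *m ecol int k = val g *m ecol int k + (q * s) *: ecol int j.
  rewrite val_SLM val_transvection // -mulmxA mulmxDl mul1mx -mulmxA; congr (_ + _).
  have -> : q *: y *m (val g *m ecol int k) = (q * s)%:M.
    rewrite -scalemxAl -scalemxAl mulmxDl -!scalemxAl !erow_mul_col -!colE 2!mxE.
    by rewrite !scale_scalar_mx -raddfD /= uv scale_scalar_mx mulr1 scale_scalar_mx.
  by rewrite mul_mx_scalar.
clearbody g2; pose w := transvection (- ecol int k) (erow int j).
apply: (central_modJ nN (w := w)); apply: (@central_diag1 _ k); first exact: congruentJ.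
rewrite conjgE !val_SLM transvectionV // opprK !val_transvection //; last first.
  by rewrite erow_ecol (negPf jk) raddf0.
have -> (A : 'M[int]_n) : A k k = (erow int k *m (A *m ecol int k)) 0 0.
  by rewrite -rowE -colE !mxE.
have wk : (1%:M + - ecol int k *m erow int j) *m ecol int k = ecol int k.
  by rewrite mulmxDl mul1mx -mulmxA erow_ecol (negPf jk) raddf0 mulmx0 addr0.
have kw : erow int k *m (1%:M + ecol int k *m erow int j) = erow int k + erow int j.
  by rewrite mulmxDr mulmx1 mulmxA erow_ecol eqxx mul1mx.
rewrite -!mulmxA wk gk mulmxA kw mulmxDl !mulmxDr -!scalemxAr !erow_ecol eqxx.
rewrite [k == j]eq_sym (negPf jk) !erow_mul_col -!colE es !mxE !mulr1n mulr0n.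
by ring.
Qed.

(** Column k is unimodular with diagonal entry a congruent to 1 modulo q, hence
    nonzero. The remaining entries are grouped as one combination c, with
    coefficients from a row of the inverse, and a suitable multiple of q c is added
    to entry i to make it prime to a. *)
Lemma central_congruent g : (3 <= n)%N -> congruent g -> central_mod N g.
Proof.
move=> n3 cg; have [M eM] := cg.
pose k := Ordinal (ltnW (ltnW n3)); pose i := Ordinal (ltnW n3); pose j := Ordinal n3.
have [ik jk ij] : [/\ i != k, j != k & i != j] by [].
pose x := val g *m ecol int k; pose z := erow int k *m invmx (val g).
have zx : z *m x = 1%:M by rewrite mulmxA mulmxKV ?SL_unitmx // erow_ecol eqxx.
have xE l : x l 0 = val g l k by rewrite /x -colE mxE.
pose y := z - z 0 k *: erow int k - z 0 i *: erow int i.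
have yi : y 0 i = 0 by rewrite !mxE !eqxx (negPf ik) mulr0 mulr1 subr0 subrr.
have yx : (y *m x) 0 0 = 1 - z 0 k * x k 0 - z 0 i * x i 0.
  by rewrite !mulmxBl zx -!scalemxAl !erow_mul_col !mxE eqxx !mulr1n.
set c := (y *m x) 0 0 in yx.
have xk : x k 0 = 1 + q * M k k by rewrite xE eM !mxE eqxx mulr1n.
have xk0 : x k 0 != 0.
  apply/eqP => xk00; have /(congr1 absz)/eqP : q * - M k k = 1.
    by rewrite mulrN; apply/eqP; rewrite eqr_oppLR -subr_eq0 opprK addrC -xk xk00.
  by rewrite abszM muln_eq1 => /andP[/eqP qq _]; move: q1 qq; clear; lia.
(* The entry x k 0 is prime to q, so the multiplier q on c costs nothing. *)
have bez : (1 - z 0 k * x k 0 - z 0 i * x i 0 + z 0 k) * x k 0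
    + z 0 i * x i 0 + (- M k k) * (q * c) = 1.
  rewrite yx; have -> : - M k k * (q * (1 - z 0 k * x k 0 - z 0 i * x i 0)) =
    (1 - x k 0) * (1 - z 0 k * x k 0 - z 0 i * x i 0) by rewrite {2}xk; ring.
  by ring.
have [t [u [v uv]]] := bezout_shift xk0 bez.
have tyi : (t *: y) 0 i = 0 by rewrite mxE yi mulr0.
have [tyi0 Nh] := proj1 (matrices_of_transvection _ _ _) (relative_elementary_row tyi).
apply: (central_mod_mull nN Nh); apply: (@central_coprime_entries _ k i j u v) => //.
  by apply: congruentM => //; exact: congruent_transvection.
have E l : val (transvection (ecol int i) (q *: (t *: y)) * g)%g l k =
    x l 0 + (l == i)%:R * (q * (t * c)).
  have -> (A : 'M[int]_n) : A l k = (A *m ecol int k) l 0 by rewrite -colE mxE.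
  rewrite val_SLM val_transvection // -mulmxA -/x mulmxDl mul1mx -mulmxA.
  rewrite -!scalemxAl [y *m x]mx11_scalar -/c !scale_scalar_mx mul_mx_scalar.
  by rewrite !mxE eqxx andbT mulrC.
rewrite !E eqxx [k == i]eq_sym (negPf ik) mul0r addr0 mul1r -uv.
by rewrite mulrCA.
Qed.

(** Every elementary matrix is a commutator of two others. *)
Lemma SL_perfect : (3 <= n)%N ->
  forall g, exists s : seq (G * G), g = (\prod_(p <- s) [~ p.1, p.2])%g.
Proof.
move=> n3 g; pose P A := exists s : seq (G * G), val (\prod_(p <- s) [~ p.1, p.2])%g = A.
suff [s /val_inj <-] : P (val g) by exists s.
apply: elementary_generation; last exact/eqP/(valP g).
  split=> [|_ _ [s <-] [s' <-]]; first by exists [::]; rewrite big_nil.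
  by exists (s ++ s'); rewrite big_cat.
move=> i j t ij.
have [k /andP[ki kj]] := third_index n3 ij.
have ki0 : erow int k *m ecol int i = 0 by rewrite erow_ecol (negPf ki) raddf0.
have jk0 : t *: erow int j *m ecol int k = 0.
  by rewrite -scalemxAl erow_ecol eq_sym (negPf kj) raddf0 scaler0.
have ji0 : t *: erow int j *m ecol int i = 0.
  by rewrite -scalemxAl erow_ecol eq_sym (negPf ij) raddf0 scaler0.
split=> //.
exists [:: (transvection (- ecol int i) (erow int k),
            transvection (- ecol int k) (t *: erow int j))].
rewrite big_seq1 transvection_comm // erow_ecol eqxx mxE mulr1n scale1r.
by rewrite val_transvection.
Qed.

(** Reduction modulo q provides the finite set of classes. *)
Lemma relative_elementary_finite_index : (3 <= n)%N -> finite_index N.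
Proof.
move=> n3.
pose f (g : G) : 'M['I_(`|q|%N.+1)]_n := \matrix_(i, j) inord `|(val g i j %% q)%Z|%N.
apply: (@finite_index_central_perfect _ _ nN _ f) => [g h z efgh|]; last exact: SL_perfect.
apply: central_congruent => //.
have E i j : (q %| val h i j - val g i j)%Z.
  rewrite -eqz_mod_dvd; have /(congr1 val) := congr1 (fun A : 'M_n => A i j) efgh.
  have lt (m : int) : (`|(m %% q)%Z| < `|q|.+1)%N.
    by have := ltz_mod m q0; have := modz_ge0 m q0; clear; lia.
  rewrite !mxE /= !inordK // => e; apply/eqP.
  by have := modz_ge0 (val g i j) q0; have := modz_ge0 (val h i j) q0; move: e; clear; lia.
pose M := \matrix_(i, j) ((val h i j - val g i j) %/ q)%Z.
have eM : val h = val g + q *: M.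
  by apply/matrixP => i j; rewrite !mxE mulrC divzK ?E // addrC subrK.
exists (invmx (val g) *m M).
by rewrite val_SLM val_SLV eM mulmxDr mulVmx ?SL_unitmx // scalemxAr.
Qed.
End CongruenceKernel.

(** * A cyclic vector *)

Section CyclicVector.
Variable F : fieldType.
Implicit Types p d : {poly F}.

(** The quotient ring by d, in the coordinates of the powers of 'X; the companion matrix is
    multiplication by 'X there. *)
Definition residue d p : 'rV[F]_(size d).-1 := poly_rV (p %% d).

Lemma residue_companion d p : d \is monic -> (1 < size d)%N ->
  residue d p *m companionmx d = residue d (p * 'X).
Proof.
move=> md sd; set m := p %% d.
have d0 : d != 0 by apply: monic_neq0.
have sm : (size m < size d)%N by rewrite ltn_modp.
set c := m`_(size d).-2.
rewrite /residue -/m; have -> : (p * 'X) %% d = m * 'X - c *: d.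
  apply/esym/(modpP (q := (p %/ d) * 'X + c%:P)).
    by rewrite -mul_polyC {1}(divp_eq p d) -/m; ring.
  rewrite -(prednK (ltnW sd)) ltnS; apply/leq_sizeP => j; rewrite coefB coefMX coefZ.
  rewrite leq_eqVlt => /predU1P[<-|dj].
    have -> : d`_(size d).-1 = 1 by apply/eqP; rewrite -monicE.
    by rewrite mulr1 -subn1 subn_eq0 leqNgt sd subn1 subrr.
  have dj1 : (size d <= j)%N by rewrite -(prednK (ltnW sd)).
  rewrite (nth_default _ dj1) mulr0 subr0; case: j dj dj1 => //= j dj _.
  by rewrite nth_default //; rewrite -ltnS (leq_trans sm) // -(prednK (ltnW sd)).
apply/rowP => k; rewrite !mxE coefB coefMX coefZ.
have dlt : ((size d).-2 < (size d).-1)%N by rewrite prednK // -subn1 subn_gt0.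
rewrite (bigD1 (Ordinal dlt)) //= !mxE /= eqxx mulrN addrC; congr (_ - _).
case: posnP => k0.
  by rewrite big1 // => j jl; rewrite !mxE ifN // k0 mulr0.
have klt : (k.-1 < (size d).-1)%N by apply: leq_ltn_trans (leq_pred k) _.
have kne : (k.-1 != (size d).-2)%N.
  by apply: contraTneq (ltn_ord k) => e; rewrite -(prednK k0) e prednK ?ltnn // -subn1 subn_gt0.
rewrite (bigD1 (Ordinal klt)) //= !mxE /= (negPf kne) prednK // eqxx mulr1.
rewrite big1 ?addr0 // => j /andP[jl jk]; rewrite !mxE ifN //.
case: eqP => [e|]; last by rewrite mulr0.
by case/eqP: jk; apply: val_inj; rewrite /= -e.
Qed.

Lemma residue_sum d I (s : seq I) (c : I -> F) (e : I -> {poly F}) :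
  \sum_(i <- s) c i *: residue d (e i) = residue d (\sum_(i <- s) c i *: e i).
Proof.
rewrite /residue (big_morph _ (id1 := 0) (op1 := +%R) (fun p q => modpD d p q)) ?mod0p //.
by rewrite linear_sum; apply: eq_bigr => i _; rewrite modpZl linearZ.
Qed.

Lemma residue_eq0 d p : d != 0 -> residue d p = 0 -> d %| p.
Proof.
move=> d0 /(congr1 rVpoly); rewrite poly_rV_K ?linear0 => [/eqP //|].
by rewrite -ltnS prednK ?ltn_modp // size_poly_gt0.
Qed.

Lemma dvdp_bigprod (I : eqType) (s : seq I) (e : I -> {poly F}) p : uniq s ->
  {in s &, forall i j, i != j -> coprimep (e i) (e j)} ->
  {in s, forall i, e i %| p} -> \prod_(i <- s) e i %| p.
Proof.
elim: s => [|i s IH] /=; first by rewrite big_nil dvd1p.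
case/andP=> is_ us cop dv; rewrite big_cons Gauss_dvdp.
  rewrite dv ?mem_head // IH // => [j k js ks|j js]; last by rewrite dv // inE js orbT.
  by apply: cop; rewrite inE ?js ?ks orbT.
have : {in s, forall j, coprimep (e i) (e j)}.
  move=> j js; apply: cop; rewrite ?mem_head ?inE ?js ?orbT //.
  by apply: contraNneq is_ => ->.
elim: s {IH is_ us cop dv} => [|j s IH] c; first by rewrite big_nil coprimep1.
rewrite big_cons coprimepMr c ?mem_head // IH // => k ks.
by rewrite c // inE ks orbT.
Qed.

(** The vector is the tuple of the classes of 1 in the quotients by the d i. A
    relation of degree below n among its translates is a polynomial divisible by all d i,
    hence by their product, which has degree n. *)
Lemma cyclic_row_vector n (A : 'M[F]_n) r (d : 'I_r -> {poly F}) :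
  rational_canonical_form A d ->
  (forall i j, i != j -> coprimep (d i) (d j)) ->
  exists w : 'rV[F]_n, forall c : 'rV[F]_n,
    \sum_(i < n) c 0 i *: (w *m A ^+ i) = 0 -> c = 0.
Proof.
case=> dE [e]; case: n / e A => A [P uP]; rewrite castmx_id => /(simmxP uP) PA cop.
have md i : d i \is monic by have [q [k [mq _ _ ->]]] := dE i; exact: monic_exp.
have sd i : (1 < size (d i))%N.
  have [q [k [mq iq k0 ->]]] := dE i.
  by rewrite -subn_gt0 subn1 size_exp muln_gt0 k0 -subn1 subn_gt0 iq.1.
set n := (\sum_i _)%N in A P uP PA *.
(* The map from polynomials to the product of the quotients by the d i. *)
pose Phi p : 'rV[F]_n := \mxrow_i residue (d i) p.
exists (Phi 1 *m P) => c; have AX k : Phi 1 *m P *m A ^+ k = Phi 'X^k *m P.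
  elim: k => [|k IH]; first by rewrite !expr0 mulmx1.
  rewrite exprSr -[A ^+ k * A]/(A ^+ k *m A) mulmxA IH -mulmxA PA mulmxA; congr (_ *m _).
  rewrite /Phi (mul_mxrow_mxdiag (fun i => residue (d i) 'X^k)).
  by apply: eq_mxrow => i; rewrite residue_companion // -exprSr.
rewrite (eq_bigr (fun i => c 0 i *: Phi 'X^i *m P)); last first.
  by move=> i _; rewrite AX scalemxAl.
rewrite -mulmx_suml => /(congr1 (mulmx^~ (invmx P))); rewrite mulmxK // mul0mx => c0.
have cE : rVpoly c = \sum_(i < n) c 0 i *: 'X^i.
  rewrite {1}[c]row_sum_delta linear_sum; apply: eq_bigr => i _.
  by rewrite linearZ /= rVpoly_delta.
have dv j : d j %| rVpoly c.
  apply: residue_eq0; first exact: monic_neq0.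
  rewrite cE -residue_sum; have := congr1 (fun v => submxrow v j) c0.
  rewrite submxrow0 submxrow_sum => H; apply: etrans H; apply: eq_bigr => i _.
  transitivity (c 0 i *: submxrow (Phi 'X^i) j); first by rewrite mxrowK.
  by apply/matrixP => a b; rewrite !mxE.
have : \prod_(i <- index_enum 'I_r) d i %| rVpoly c.
  apply: dvdp_bigprod => [|i j _ _|j _]; [exact: index_enum_uniq | exact: cop | exact: dv].
have [e|c'0] := eqVneq (rVpoly c) 0; first by move=> _; rewrite -[c]rVpolyK e linear0.
move/(dvdp_leq c'0); rewrite size_prod; last by move=> i _; exact: monic_neq0.
have -> : (\sum_(i < r) size (d i) = n + #|'I_r|)%N.
  rewrite -sum1_card -big_split /=; apply: eq_bigr => i _.
  by rewrite addn1 prednK // ltnW.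
by rewrite subSn ?leq_addl // addnK ltnNge size_poly.
Qed.
End CyclicVector.

(** * Transvections up to a positive multiple *)

Section VirtualTransvections.
Variables (n : nat) (P : 'M[rat]_n -> Prop).
Hypothesis cP : mul_closed P.
Implicit Types (x v : 'cV[rat]_n) (y w : 'rV[rat]_n) (k : nat) (t : int).

(** The submonoid contains the transvections along x and y for all multiples of some k.
    This makes the condition stable under rational scaling, so that all
    denominators can be ignored until the end. *)
Definition virtual_transv x y :=
  exists2 k, (0 < k)%N & forall t, transv_in P ((k%:Z * t)%:~R *: x) y.

Lemma virtual_transvZl a x y : virtual_transv x y -> virtual_transv (a *: x) y.
Proof.
case=> k k0 Pk; exists (k * `|denq a|)%N; first by rewrite muln_gt0 k0 absz_gt0 denq_neq0.
move=> t; have := Pk (numq a * t); congr (transv_in P _ y); rewrite scalerA; congr (_ *: _).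
rewrite PoszM absz_denq !intrM -!mulrA; congr (_ * _).
by rewrite numqE; ring.
Qed.

Lemma virtual_transvDl x x' y :
  virtual_transv x y -> virtual_transv x' y -> virtual_transv (x + x') y.
Proof.
move=> [k k0 Pk] [k' k'0 Pk']; exists (k * k')%N; first by rewrite muln_gt0 k0.
move=> t; rewrite scalerDr; apply: transv_inDl => //.
  by have := Pk (k'%:Z * t); rewrite mulrA -PoszM.
by have := Pk' (k%:Z * t); rewrite mulrA -PoszM mulnC.
Qed.

(** The commutator rule, freed from the scalar y x'. *)
Lemma virtual_transv_comm x y x' y' : virtual_transv x y -> virtual_transv x' y' ->
  y *m x' != 0 -> y' *m x = 0 -> virtual_transv x y'.
Proof.
move=> [k k0 Pk] [k' k'0 Pk'] yx' yx0; set c := (y *m x') 0 0.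
have c0 : c != 0.
  by apply: contraNneq yx' => c0; rewrite [_ *m _]mx11_scalar -/c c0 raddf0.
suff : virtual_transv (c *: x) y' by move/(virtual_transvZl c^-1); rewrite scalerA mulVf // scale1r.
exists (k * k')%N => [|t]; first by rewrite muln_gt0 k0.
have := @transv_in_comm _ _ P ((k%:Z * t)%:~R *: x) y ((k'%:Z * 1)%:~R *: x') y' cP (Pk t).
have Nk : transv_in P (- ((k%:Z * t)%:~R *: x)) y.
  by have := Pk (- t); rewrite mulrN rmorphN scaleNr.
have Nk' : transv_in P (- ((k'%:Z * 1)%:~R *: x')) y'.
  by have := Pk' (- 1); rewrite mulrN rmorphN scaleNr.
move=> /(_ Nk (Pk' 1) Nk'); rewrite -scalemxAr yx0 scaler0 => /(_ erefl).
congr (transv_in P _ y'); rewrite -scalemxAr mxE -/c !scalerA; congr (_ *: _).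
by rewrite PoszM !intrM; ring.
Qed.

Lemma virtual_transv0l y : virtual_transv 0 y.
Proof. by exists 1%N => // t; rewrite scaler0; exact: transv_in0l. Qed.

Lemma virtual_transv_suml I (r : seq I) (Q : pred I) (f : I -> 'cV[rat]_n) y :
  (forall i, Q i -> virtual_transv (f i) y) -> virtual_transv (\sum_(i <- r | Q i) f i) y.
Proof.
apply: (big_ind (fun x => virtual_transv x y)) => [|x x'].
  exact: virtual_transv0l.
exact: virtual_transvDl.
Qed.
End VirtualTransvections.

Section CyclicOrbit.
Variables (n : nat) (P : 'M[rat]_n -> Prop).
Hypothesis (n3 : (3 <= n)%N) (cP : mul_closed P).
(* The column v i stands for g^-i v 0; only the relation gv between them matters. *)
Variables (g : 'M[rat]_n) (w : 'rV[rat]_n) (v : nat -> 'cV[rat]_n).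

Definition orbit_row j := w *m g ^+ j.
Definition krylov : 'M[rat]_n := \matrix_(i < n) orbit_row i.

Hypothesis gv : forall i, g *m v i.+1 = v i.
Hypothesis uK : krylov \in unitmx.
Hypothesis wv0 : forall j, (j < n.-1)%N -> orbit_row j *m v 0%N = 0.
Hypothesis wv_last : orbit_row n.-1 *m v 0%N != 0.
Hypothesis Pv : forall i, virtual_transv P (v i) (orbit_row i).

Lemma orbit_row_shift i j : orbit_row (j + i) *m v i = orbit_row j *m v 0%N.
Proof.
elim: i => [|i IH]; first by rewrite addn0.
by rewrite addnS /orbit_row exprSr -[_ * g]/(_ *m g) mulmxA -mulmxA gv.
Qed.

Lemma row_krylov (i : 'I_n) : row i krylov = orbit_row i.
Proof. by rewrite rowK. Qed.

(** By shift invariance this is w (v 1). Were it zero, v 1 would be orthogonal to the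
    whole basis: the other rows pair with it as earlier rows do with v 0. *)
Lemma orbit_row_next i : orbit_row i *m v i.+1 != 0.
Proof.
have -> : orbit_row i *m v i.+1 = orbit_row 0 *m v 1%N.
  elim: i => // i IH; rewrite -IH {1}/orbit_row exprSr -[_ * g]/(_ *m g).
  by rewrite mulmxA -mulmxA gv.
apply/eqP => e; case/eqP: wv_last.
suff Kv : krylov *m v 1%N = 0.
  by rewrite -(gv 0) -(mulKmx uK (v 1%N)) Kv !mulmx0.
apply/row_matrixP => l; rewrite row_mul row_krylov row0.
case: l => -[|l] /= ln //.
by rewrite -(addn1 l) orbit_row_shift wv0 // -ltnS prednK // (ltn_trans _ n3).
Qed.

(** Induction on j - i, applying the commutator rule to (v i, w_i) and
    (v i.+1, w_j). *)
Lemma virtual_transv_orbit i j : (i <= j)%N -> (j - i < n.-1)%N ->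
  virtual_transv P (v i) (orbit_row j).
Proof.
move=> ij; move: {2}(j - i)%N (erefl (j - i)%N) => m; elim: m i ij => [|m IH] i ij ijm jn.
  by have -> : j = i by [lia]; exact: Pv.
have ij' : (i.+1 <= j)%N by lia.
apply: (virtual_transv_comm cP (Pv i) (IH i.+1 ij' _ _)); [lia | lia | exact: orbit_row_next |].
by rewrite -(subnK ij) orbit_row_shift wv0.
Qed.

(* The basis dual to the rows of krylov. *)
Let b (l : 'I_n) : 'cV[rat]_n := col l (invmx krylov).

Lemma orbit_row_dual (j l : 'I_n) : orbit_row j *m b l = (j == l)%:R%:M.
Proof.
rewrite -row_krylov /b colE mulmxA -row_mul mulmxV // rowE mulmx1.
exact: erow_ecol.
Qed.

Lemma dual_expansion (x : 'cV[rat]_n) : x = \sum_(l < n) (orbit_row l *m x) 0 0 *: b l.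
Proof.
rewrite -{1}(mulKmx uK x) [krylov *m x]cV_sum_ecol mulmx_sumr; apply: eq_bigr => l _.
by rewrite -scalemxAr /b colE -row_krylov -row_mul [in RHS]mxE.
Qed.

Let ltn1 : (n.-1 < n)%N. Proof. by rewrite prednK // (ltn_trans _ n3). Qed.
Let last : 'I_n := Ordinal ltn1.

(** The rows w_j with j > l kill v l.+1, so v l.+1 is a combination of b 0, ..., b l,
    with nonzero coefficient at b l by orbit_row_next; the earlier b's are covered by
    induction. *)
Lemma virtual_transv_dual_upper (l j : 'I_n) : (l < j)%N ->
  virtual_transv P (b l) (orbit_row j).
Proof.
move: {2}(l.+1) (ltnSn l) => m; elim: m l => // m IH l lm lj.
have vl : virtual_transv P (v l.+1) (orbit_row j).
  by apply: virtual_transv_orbit => //; have := ltn_ord j; move: lj; clear; lia.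
have c0 : (orbit_row l *m v l.+1) 0 0 != 0.
  apply: contraNneq (orbit_row_next l) => e; by rewrite [_ *m _]mx11_scalar e raddf0.
suff : virtual_transv P ((orbit_row l *m v l.+1) 0 0 *: b l) (orbit_row j).
  by move/(virtual_transvZl ((orbit_row l *m v l.+1) 0 0)^-1); rewrite scalerA mulVf ?scale1r.
have := dual_expansion (v l.+1); rewrite (bigD1 l) //= => /esym/(canRL (addrK _)) ->.
apply: virtual_transvDl => //; rewrite -scaleN1r; apply: virtual_transvZl.
apply: virtual_transv_suml => // k kl.
have [ltkl|] := ltnP k l.
  by apply: virtual_transvZl; apply: IH; [exact: leq_trans ltkl _ | exact: ltn_trans ltkl lj].
rewrite leq_eqVlt eq_sym val_eqE (negPf kl) /= => ltlk.
rewrite -(subnK ltlk) orbit_row_shift wv0 ?mxE ?scale0r; first exact: virtual_transv0l.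
by have := ltn_ord k; move: ltlk; clear; lia.
Qed.

(** The column v 0 is a multiple of the last dual vector, which gives the pairs
    (b last, w_l). A pair (b i, w_j) with j < i is then the commutator of (b i, w_last) and
    (b last, w_j). *)
Lemma virtual_transv_dual (i j : 'I_n) : i != j -> virtual_transv P (b i) (orbit_row j).
Proof.
move=> ij; have blast l : (l < n.-1)%N -> virtual_transv P (b last) (orbit_row l).
  move=> ln; have := virtual_transv_orbit (leq0n l); rewrite subn0 => /(_ ln).
  rewrite [v 0%N]dual_expansion (bigD1 last) //= big1 ?addr0 => [
    /(virtual_transvZl ((orbit_row n.-1 *m v 0%N) 0 0)^-1)|k kl].
    rewrite scalerA mulVf ?scale1r //.
    by apply: contraNneq wv_last => e; rewrite [_ *m _]mx11_scalar e raddf0.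
  rewrite wv0 ?mxE ?scale0r //; have := ltn_ord k; move: kl; rewrite -val_eqE /=; clear; lia.
have [ltij|] := ltnP i j; first exact: virtual_transv_dual_upper.
rewrite leq_eqVlt eq_sym val_eqE (negPf ij) /= => ltji.
have jn : (j < n.-1)%N by have := ltn_ord i; move: ltji; clear; lia.
have [->|il] := eqVneq i last; first exact: blast.
have iln : (i < last)%N by have := ltn_ord i; move: il; rewrite -val_eqE /=; clear; lia.
apply: (virtual_transv_comm cP (virtual_transv_dual_upper iln) (blast _ jn)).
  rewrite (orbit_row_dual last last) eqxx; apply/eqP => /(congr1 (fun A : 'M[rat]_1 => A 0 0)).
  by rewrite !mxE.
by rewrite orbit_row_dual eq_sym (negPf ij) raddf0.
Qed.
End CyclicOrbit.

(** * Finite index from a cyclic vector *)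

Lemma common_multiple (T : finType) (Q : T -> int -> Prop) :
  (forall x, exists2 k : nat, (0 < k)%N & forall t, Q x (k%:Z * t)) ->
  exists2 q : nat, (1 < q)%N & forall x t, Q x (q%:Z * t).
Proof.
move=> Qk; have /choice[k kP] : forall x, exists k : nat, (0 < k)%N /\ forall t, Q x (k%:Z * t).
  by move=> x; have [k k0 H] := Qk x; exists k.
have k0 : (0 < \prod_x k x)%N by apply: prodn_gt0 => x; case: (kP x).
(* The factor 2 is there for 1 < q. *)
exists (2 * \prod_x k x)%N => [|x t]; first by move: k0; clear; lia.
rewrite (bigD1 x) //= mulnCA PoszM -mulrA; exact: (kP x).2.
Qed.

Lemma clear_denominators m n (A : 'M[rat]_(m, n)) :
  exists2 q : nat, (1 < q)%N & exists B : 'M[int]_(m, n), q%:R *: A = map_mx intr B.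
Proof.
pose Q (ij : 'I_m * 'I_n) (t : int) := exists z : int, t%:~R * A ij.1 ij.2 = z%:~R.
have [|q q1 Qq] := @common_multiple _ Q.
  move=> [i j]; exists `|denq (A i j)|%N; first by rewrite absz_gt0 denq_neq0.
  move=> t; exists (t * numq (A i j)).
  by rewrite absz_denq !intrM numqE /=; ring.
exists q => //; exists (\matrix_(i, j) numq (q%:R * A i j)).
apply/matrixP => i j; rewrite !mxE; have [z] := Qq (i, j) 1.
by rewrite mulr1 /= pmulrn => ->; rewrite numq_int.
Qed.

Lemma map_intr_inj m n : injective (map_mx intr : 'M[int]_(m, n) -> 'M[rat]_(m, n)).
Proof.
move=> A B /matrixP e; apply/matrixP => i j; apply: (@intr_inj rat).
by have := e i j; rewrite !mxE.
Qed.

Section Commensurable.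
Variables (n : nat) (H : set (SL int n)).
Hypothesis sH : subgroup H.

(** The group H seen inside the rational matrices, where bases that are not
    unimodular can be used. *)
Definition rational_matrices (A : 'M[rat]_n) := exists2 h, H h & map_mx intr (val h) = A.

Lemma rational_matrices_mul_closed : mul_closed rational_matrices.
Proof.
case: sH => [H1 HM _]; split; first by exists 1%g; rewrite // val_SL1 map_mx1.
move=> _ _ [a Ha <-] [b Hb <-]; exists (a * b)%g; first exact: HM.
by rewrite val_SLM map_mxM.
Qed.

(** Conjugation by W turns the hypothesis into elementary matrices with entries in q Z
    for a common q, to which transv_in_of_elementary applies with the integral vectors
    W x, y B and z B, where B is d times the inverse of W. Both y B W x = d (y x)
    and z B W x = d, so K = (q d)^2. *)
Lemma relative_elementary_sub (W : 'M[int]_n) : (3 <= n)%N ->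
  map_mx intr W \in @unitmx rat n ->
  (forall i j, i != j ->
     virtual_transv rational_matrices (col i (invmx (map_mx intr W))) (row j (map_mx intr W))) ->
  exists2 K : int, 1 < K & relative_elementary K `<=` H.
Proof.
set Wq := map_mx _ W => n3 uW HW.
have [d d1 [B eB]] := clear_denominators (invmx Wq).
pose P (A : 'M[int]_n) := rational_matrices (invmx Wq *m map_mx intr A *m Wq).
have [_ RM] := rational_matrices_mul_closed.
have cP : mul_closed P.
  split=> [|A C PA PC]; rewrite /P.
    by rewrite map_mx1 mulmx1 mulVmx //; exact: rational_matrices_mul_closed.1.
  have := RM _ _ PA PC; congr rational_matrices.
  by rewrite map_mxM !mulmxA mulmxK //.
have [|q q1 HP] := @common_multiple _ (fun (ij : 'I_n * 'I_n) t =>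
    ij.1 != ij.2 -> transv_in P (t *: ecol int ij.1) (erow int ij.2)).
  move=> [i j] /=; have [<-|ij] := eqVneq i j; first by exists 1%N => // t; rewrite eqxx.
  have [k k0 Hk] := HW i j ij; exists k => // t _; have [_ Ht] := Hk t; split.
    by rewrite -scalemxAr erow_ecol eq_sym (negPf ij) raddf0 scaler0.
  move: Ht; rewrite /P; congr rational_matrices.
  rewrite raddfD /= map_mx1 map_mxM map_mxZ /= /ecol /erow !map_delta_mx.
  rewrite mulmxDr mulmx1 mulmxDl mulVmx //; congr (_ + _).
  by rewrite -?scalemxAl -?scalemxAr -?scalemxAl colE rowE !mulmxA.
exists ((q * d) ^ 2)%N%:Z; first by move: q1 d1; clear; nia.
apply: generated_min => // _ [x [y [z [yx zx ->]]]].
have BW : B *m W = d%:Z%:M.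
  apply: map_intr_inj; rewrite map_mxM -eB -scalemxAl mulVmx //.
  by rewrite map_scalar_mx /= scalemx1.
pose xi := W *m x; pose eta := y *m B; pose zeta := (z *m B)^T.
have E (u : 'rV[int]_n) : u *m B *m xi = d%:Z *: (u *m x).
  by rewrite mulmxA -(mulmxA u) BW mul_mx_scalar scalemxAl.
have := @transv_in_of_elementary _ _ P q%:Z xi eta zeta n3 cP.
case=> [i j t ij||].
- by apply/transv_inC; exact: (HP (i, j)) ij.
- by rewrite E yx scaler0.
rewrite /zeta trmxK E zx => _.
set K := ((q * d) ^ 2)%N%:Z.
have Kyx : K *: y *m x = 0 by rewrite -scalemxAl yx scaler0.
case=> h Hh eh; suff <- : h = transvection x (K *: y) by [].
apply: val_inj; apply: map_intr_inj; rewrite eh val_transvection //.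
have BWq : map_mx intr B *m Wq = d%:R%:M.
  by rewrite -eB -scalemxAl mulVmx // scalemx1.
rewrite !map_mxD !map_mx1 mulmxDr mulmx1 mulmxDl mulVmx //; congr (_ + _).
rewrite !map_mxM !map_mxZ /= /eta map_mxM -!scalemxAr -scalemxAl.
rewrite -!mulmxA BWq mul_mx_scalar -!scalemxAr mulKmx // scalerA; congr (_ *: _).
rewrite !mxE /= mulr1n mulr1 /K -mulnn !PoszM pmulrn !intrM; ring.
Qed.
End Commensurable.

Lemma transvectionX (R : comUnitRingType) n (x : 'cV[R]_n) (y : 'rV[R]_n) k :
  y *m x = 0 -> (transvection x y ^+ k)%g = transvection (x *+ k) y.
Proof.
move=> yx; elim: k => [|k IH].
  by apply: val_inj; rewrite val_transvection ?mulr0n ?mulmx0 // mul0mx addr0.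
by rewrite expgS IH transvectionM // -?mulrS // -scaler_nat -scalemxAr yx scaler0.
Qed.

Lemma transvection_multiples (n : nat) (H : set (SL int n)) (x : 'cV[int]_n) (y : 'rV[int]_n)
    (m : nat) (t : int) : subgroup H -> y *m x = 0 ->
  H (transvection x y ^+ m)%g -> H (transvection ((m%:Z * t) *: x) y).
Proof.
move=> sH yx Hm; have [_ _ HV] := sH.
have Hn (k : nat) : H (transvection ((m%:Z * k%:Z) *: x) y).
  by rewrite -PoszM -natz scaler_nat -transvectionX // expgnA; exact: subgroupX.
case: t => k //; rewrite NegzE mulrN scaleNr -transvectionV; first exact/HV/Hn.
by rewrite -scalemxAr yx scaler0.
Qed.

Lemma transvection_unipotent (R : comUnitRingType) n (x : 'cV[R]_n) (y : 'rV[R]_n) :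
  y *m x = 0 -> unipotent (transvection x y).
Proof.
move=> yx; exists 2%N; rewrite val_transvection // addrAC subrr add0r expr2.
by rewrite -[_ * _]/(_ *m _) -mulmxA [y *m _]mulmxA yx mul0mx mulmx0.
Qed.

Lemma map_SLX n (g : SL int n) k :
  map_mx intr (val (g ^+ k)%g) = (map_mx intr (val g) : 'M[rat]_n) ^+ k.
Proof.
elim: k => [|k IH]; first by rewrite val_SL1 map_mx1 expr0.
by rewrite expgS exprS val_SLM map_mxM IH.
Qed.

Lemma cyclic_krylov_unit n (A : 'M[rat]_n) (w : 'rV[rat]_n) :
  (forall c : 'rV[rat]_n, \sum_(i < n) c 0 i *: (w *m A ^+ i) = 0 -> c = 0) ->
  krylov A w \in unitmx.
Proof.
move=> wfree; rewrite -row_free_unit; apply: inj_row_free => c c0; apply: wfree.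
by apply: etrans c0; rewrite mulmx_sum_row; apply: eq_bigr => i _; rewrite row_krylov.
Qed.

Theorem theorem2 (n : nat) (g : SL int n) (r : nat) (d : 'I_r -> {poly rat})
    (f : 'I_r -> {poly rat}) :
  (3 <= n)%N ->
  rational_canonical_form (map_mx intr (val g)) d ->
  (forall i : 'I_r, f i = char_poly (companionmx (d i))) ->
  (forall i j : 'I_r, i != j -> coprimep (f i) (f j)) ->
  exists u : SL int n,
    unipotent u /\
    forall m : nat, (1 <= m)%N ->
      finite_index (generated [set g; (u ^+ m)%g]).
Proof.
move=> n3 rcf fE cop.
have fd i : f i = d i.
  rewrite fE companionmxK //; case: (rcf.1 i) => p [k [mp _ _ ->]]; exact: monic_exp.
have {}cop i j : i != j -> coprimep (d i) (d j) by move/cop; rewrite !fd.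
set G := map_mx intr (val g) in rcf.
have [w0 w0free] := cyclic_row_vector rcf cop.
have [c c1 [w ew]] := clear_denominators w0.
set wq : 'rV[rat]_n := map_mx intr w in ew.
have uK : krylov G wq \in unitmx.
  apply: cyclic_krylov_unit => a; rewrite -ew => a0; apply: w0free.
  have c0 : (c%:R : rat) != 0 by rewrite pnatr_eq0 -lt0n (ltn_trans _ c1).
  apply: (scalerI c0); rewrite scaler0 -[RHS]a0 scaler_sumr; apply: eq_bigr => i _.
  by rewrite -scalemxAl !scalerA mulrC.
have ln : (n.-1 < n)%N by rewrite prednK // (ltn_trans _ n3).
(* The column on which all rows of the Krylov matrix but the last vanish. *)
have [c' c'1 [v ev]] := clear_denominators (invmx (krylov G wq) *m ecol rat (Ordinal ln)).
have Kv : krylov G wq *m map_mx intr v = c'%:R *: ecol rat (Ordinal ln).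
  by rewrite -ev -scalemxAr mulKVmx.
have wvE (j : 'I_n) : orbit_row G wq j *m map_mx intr v = (c'%:R * (j == Ordinal ln)%:R)%:M.
  rewrite -row_krylov -row_mul Kv; apply/matrixP => a b.
  by rewrite !ord1 !mxE eqxx andbT mulr1n.
have wv : w *m v = 0.
  apply: map_intr_inj; rewrite map_mxM map_mx0.
  have := wvE (Ordinal (ltn_trans (isT : 0 < 2)%N n3)).
  rewrite /orbit_row expr0 mulmx1 => ->.
  rewrite -val_eqE /= ltn_eqF ?mulr0 ?raddf0 //.
  by rewrite -ltnS prednK // (ltn_trans _ n3).
exists (transvection v w); split; first exact: transvection_unipotent.
move=> m m0; set H := generated _.
have sH : subgroup H by exact: generated_subgroup.
have [H1 HM HV] := sH.
have Hg : H g by apply: sub_generated; left.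
have Hu : H (transvection v w ^+ m)%g by apply: sub_generated; right.
pose W := \matrix_(i < n) (w *m val (g ^+ i)%g).
have eW : map_mx intr W = krylov G wq.
  by apply/row_matrixP => i; rewrite row_krylov -map_row rowK map_mxM map_SLX.
pose vs i : 'cV[rat]_n := map_mx intr (val (g ^- i)%g *m v).
have vs0 : vs 0%N = map_mx intr v by rewrite /vs expg0 invg1 val_SL1 mul1mx.
have gvs i : G *m vs i.+1 = vs i.
  rewrite /vs -map_mxM mulmxA -val_SLM; congr (map_mx _ (val _ *m _)).
  by rewrite expgSr invgM mulVKg.
have [||K K1 KH] := @relative_elementary_sub n H sH W n3; first by rewrite eW.
  rewrite eW => i j ij; rewrite row_krylov.
  apply: (virtual_transv_dual n3 (rational_matrices_mul_closed sH) gvs uK) => // [l ll||l].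
  - rewrite vs0 (wvE (Ordinal (leq_trans ll (leq_pred n)))) -val_eqE /=.
    by rewrite ltn_eqF // mulr0 raddf0.
  - rewrite vs0 (wvE (Ordinal ln)) eqxx mulr1; apply/eqP => /(congr1 (fun A : 'M[rat]_1 => A 0 0)).
    by rewrite !mxE mulr1n => /eqP; rewrite pnatr_eq0 -leqn0 leqNgt (ltn_trans _ c'1).
  exists m => // t; pose h := (transvection ((m%:Z * t) *: v) w ^ (g ^+ l))%g.
  have tvw : w *m ((m%:Z * t) *: v) = 0 by rewrite -scalemxAr wv scaler0.
  have Hh : H h.
    have Hl := subgroupX l sH Hg.
    by rewrite /h conjgE; exact: HM (HV _ Hl) (HM _ _ (transvection_multiples t sH wv Hu) Hl).
  have ol : orbit_row G wq l = map_mx intr (w *m val (g ^+ l)%g) by rewrite map_mxM map_SLX.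
  have hE : val h = 1%:M + ((m%:Z * t) *: (val (g ^- l)%g *m v)) *m (w *m val (g ^+ l)%g).
    rewrite /h transvectionJ // val_transvection -?scalemxAr //.
    by rewrite mulmxA mulmxK ?SL_unitmx // wv scaler0.
  split.
    by rewrite ol -scalemxAr -map_mxM mulmxA -(mulmxA w) -val_SLM mulgV mulmx1 wv map_mx0 scaler0.
  by exists h => //; rewrite hE map_mxD map_mx1 map_mxM map_mxZ ol.
apply: (@finite_index_sub _ (relative_elementary K)) => //.
  by case: (relative_elementary_normal n K) => [[]].
exact: relative_elementary_finite_index.
Qed.
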